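(* Let $f\in\mathcal W_{\mathbb H}$. The following are equivalent: (i) $f$ is invertible in $\mathcal W_{\mathbb H}$ (with respect to the $\star$-product); (ii) let $i$ be any fixed element of $\mathbb S$ (with $j\in\mathbb S$ orthogonal to $i$ and $\omega=\omega_{i,j}$); then $\det\big(\omega(f)(z)\big)\neq 0$ for all $z\in\partial\mathbb B\cap\mathbb C_i$; (iii) the function $f$ does not vanish on $\partial\mathbb B$, i.e. $f(p)\ne 0$ for every $p\in\partial\mathbb B$.
   Context: $\mathbb H$ is the real algebra of quaternions, $|\cdot|$ the quaternionic modulus, $\mathbb S=\{q\in\mathbb H: q^2=-1\}$ the sphere of unit purely imaginary quaternions, $\mathbb B=\{p\in\mathbb H:|p|<1\}$, $\partial\mathbb B=\{p\in\mathbb H:|p|=1\}$. For $i\in\mathbb S$, $\mathbb C_i=\{x+iy: x,y\in\mathbb R\}$, identified with $\mathbb C$. Two elements $i,j\in\mathbb S$ are orthogonal if $ij+ji=0$; then every quaternion is uniquely $q=z+wj$ with $z,w\in\mathbb C_i$, and $\chi=\chi_{i,j}:\mathbb H\to\mathbb C^{2\times2}$ is the injective ring homomorphism $\chi(z+wj)=\begin{pmatrix} z& w\\ -\overline w&\overline z\end{pmatrix}$. $\mathcal W_{\mathbb H}$ is the set of functions $f(p)=\sum_{u\in\mathbb Z}p^uf_u$, $p\in\partial\mathbb B$, with $f_u\in\mathbb H$ and $\sum_{u\in\mathbb Z}|f_u|<\infty$ (the coefficients are uniquely determined by $f$). The product is $(f\star g)(p)=\sum_{u\in\mathbb Z}p^u\big(\sum_{k\in\mathbb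 Z}f_{u-k}g_k\big)$, with unit the constant function $1$. For $f\in\mathcal W_{\mathbb H}$ with $f_u=a_u+b_uj$, $a_u,b_u\in\mathbb C_i$, put $a(z)=\sum_u z^ua_u$, $b(z)=\sum_u z^ub_u$ and $$\omega(f)(z)=\omega_{i,j}(f)(z)=\begin{pmatrix}a(z)&b(z)\\-\overline{b(\bar z)}&\overline{a(\bar z)}\end{pmatrix}=\sum_{u\in\mathbb Z}z^u\chi(f_u),\qquad z\in\mathbb C_i,\ |z|=1.$$ *)

(* Defs.v *)
From HB Require Import structures.
From mathcomp Require Import all_boot all_order all_algebra.
From mathcomp Require Import all_classical all_reals all_analysis.
From mathcomp Require Import ring lra.

Set Implicit Arguments.
Unset Strict Implicit.
Unset Printing Implicit Defensive.

Import Order.TTheory GRing.Theory Num.Theory.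
Import numFieldNormedType.Exports.

Local Open Scope classical_set_scope.
Local Open Scope ring_scope.

(** * The normed division algebra of real quaternions *)

(* [Quat a b c d] is a + b e1 + c e2 + d e3 with e1 e2 = e3. *)
Record quat (R : Type) : Type := Quat { q0 : R; q1 : R; q2 : R; q3 : R }.

Section QuatChoice.
Variable R : Type.

Definition quat_to_prod (q : quat R) : R * R * R * R :=
  (q0 q, q1 q, q2 q, q3 q).
Definition prod_to_quat (t : R * R * R * R) : quat R :=
  let: (a, b, c, d) := t in Quat a b c d.

Lemma quat_to_prodK : cancel quat_to_prod prod_to_quat.
Proof. by case. Qed.

Lemma quatP (p q : quat R) :
  q0 p = q0 q -> q1 p = q1 q -> q2 p = q2 q -> q3 p = q3 q -> p = q.
Proof. by case: p; case: q => /= a b c d x y z t -> -> -> ->. Qed.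

End QuatChoice.

HB.instance Definition _ (R : choiceType) :=
  Choice.copy (quat R) (can_type (@quat_to_prodK R)).

Section QuatRing.
Variable R : realType.
Implicit Types p q r : quat R.

Definition addq p q :=
  Quat (q0 p + q0 q) (q1 p + q1 q) (q2 p + q2 q) (q3 p + q3 q).
Definition oppq p := Quat (- q0 p) (- q1 p) (- q2 p) (- q3 p).
Definition zeroq : quat R := Quat 0 0 0 0.

Lemma addqA : associative addq.
Proof. by move=> p q r; apply: quatP; rewrite /= addrA. Qed.
Lemma addqC : commutative addq.
Proof. by move=> p q; apply: quatP; rewrite /= addrC. Qed.
Lemma add0q : left_id zeroq addq.
Proof. by move=> p; apply: quatP; rewrite /= add0r. Qed.
Lemma addNq : left_inverse zeroq oppq addq.
Proof. by move=> p; apply: quatP; rewrite /= addNr. Qed.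

HB.instance Definition _ :=
  GRing.isZmodule.Build (quat R) addqA addqC add0q addNq.

Definition mulq p q := Quat
  (q0 p * q0 q - q1 p * q1 q - q2 p * q2 q - q3 p * q3 q)
  (q0 p * q1 q + q1 p * q0 q + q2 p * q3 q - q3 p * q2 q)
  (q0 p * q2 q - q1 p * q3 q + q2 p * q0 q + q3 p * q1 q)
  (q0 p * q3 q + q1 p * q2 q - q2 p * q1 q + q3 p * q0 q).
Definition oneq : quat R := Quat 1 0 0 0.

Lemma mulqA : associative mulq.
Proof. by move=> p q r; apply: quatP => /=; ring. Qed.
Lemma mul1q : left_id oneq mulq.
Proof. by move=> p; apply: quatP => /=; ring. Qed.
Lemma mulq1 : right_id oneq mulq.
Proof. by move=> p; apply: quatP => /=; ring. Qed.
Lemma mulqDl : left_distributive mulq +%R.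
Proof. by move=> p q r; apply: quatP => /=; ring. Qed.
Lemma mulqDr : right_distributive mulq +%R.
Proof. by move=> p q r; apply: quatP => /=; ring. Qed.
Lemma oneq_neq0 : oneq != 0.
Proof. by apply/eqP => -[] /eqP; rewrite oner_eq0. Qed.

HB.instance Definition _ := GRing.Zmodule_isNzRing.Build (quat R)
  mulqA mul1q mulq1 mulqDl mulqDr oneq_neq0.

Definition scaleq (a : R) q := Quat (a * q0 q) (a * q1 q) (a * q2 q) (a * q3 q).

Lemma scaleqA a b q : scaleq a (scaleq b q) = scaleq (a * b) q.
Proof. by apply: quatP; rewrite /= mulrA. Qed.
Lemma scale1q : left_id 1 scaleq.
Proof. by move=> q; apply: quatP; rewrite /= mul1r. Qed.
Lemma scaleqDr : right_distributive scaleq +%R.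
Proof. by move=> a p q; apply: quatP; rewrite /= mulrDr. Qed.
Lemma scaleqDl q : {morph scaleq^~ q : a b / a + b}.
Proof. by move=> a b; apply: quatP; rewrite /= mulrDl. Qed.

HB.instance Definition _ := GRing.Zmodule_isLmodule.Build R (quat R)
  scaleqA scale1q scaleqDr scaleqDl.

Lemma scaleqAl (a : R) p q : a *: (p * q) = (a *: p) * q.
Proof. by apply: quatP => /=; ring. Qed.
HB.instance Definition _ := GRing.Lmodule_isLalgebra.Build R (quat R) scaleqAl.

Lemma scaleqAr (a : R) p q : a *: (p * q) = p * (a *: q).
Proof. by apply: quatP => /=; ring. Qed.
HB.instance Definition _ := GRing.Lalgebra_isAlgebra.Build R (quat R) scaleqAr.

Definition conjq q := Quat (q0 q) (- q1 q) (- q2 q) (- q3 q).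

Definition sqnormq q := q0 q ^+ 2 + q1 q ^+ 2 + q2 q ^+ 2 + q3 q ^+ 2.

Lemma sqnormq_ge0 q : 0 <= sqnormq q.
Proof. by rewrite !addr_ge0 ?sqr_ge0. Qed.

Lemma sqnormq_eq0 q : (sqnormq q == 0) = (q == 0).
Proof.
apply/eqP/eqP => [|->]; last by rewrite /sqnormq /= !expr0n !addr0.
move=> /eqP; rewrite !paddr_eq0 ?addr_ge0 ?sqr_ge0// !sqrf_eq0.
by move=> /andP[/andP[/andP[/eqP ? /eqP ?] /eqP ?] /eqP ?]; apply: quatP.
Qed.

Definition invq q := (sqnormq q)^-1 *: conjq q.

Lemma mulVq : {in [pred q | q != 0], left_inverse 1 invq *%R}.
Proof.
move=> q; rewrite inE -sqnormq_eq0 => nz.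
by apply: quatP => /=; rewrite /sqnormq in nz *; field.
Qed.

Lemma mulqV : {in [pred q | q != 0], right_inverse 1 invq *%R}.
Proof.
move=> q; rewrite inE -sqnormq_eq0 => nz.
by apply: quatP => /=; rewrite /sqnormq in nz *; field.
Qed.

Lemma unitqP p q : q * p = 1 /\ p * q = 1 -> p != 0.
Proof.
by move=> [+ _]; case: eqP => // -> /eqP; rewrite mulr0 eq_sym oner_eq0.
Qed.

Lemma invq_out : {in [predC [pred q | q != 0]], invq =1 id}.
Proof.
move=> q; rewrite !inE negbK => /eqP ->.
by apply: quatP; rewrite /= ?oppr0 mulr0.
Qed.

HB.instance Definition _ := GRing.NzRing_hasMulInverse.Build (quat R)
  mulVq mulqV unitqP invq_out.

Definition normq q : R := Num.sqrt (sqnormq q).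

Lemma ler_normqD p q : normq (p + q) <= normq p + normq q.
Proof.
have n0 r : 0 <= normq r by exact: sqrtr_ge0.
rewrite -(@ler_pXn2r _ 2) ?nnegrE ?addr_ge0// sqrrD.
rewrite !sqr_sqrtr ?sqnormq_ge0//.
set D := q0 p * q0 q + q1 p * q1 q + q2 p * q2 q + q3 p * q3 q.
have -> : sqnormq (p + q) = sqnormq p + D *+ 2 + sqnormq q.
  by rewrite /sqnormq /D /=; ring.
rewrite lerD2r lerD2l lerMn2r /=.
apply: (le_trans (ler_norm D)).
rewrite -(@ler_pXn2r _ 2) ?nnegrE ?mulr_ge0// exprMn.
rewrite !sqr_sqrtr ?sqnormq_ge0// real_normK ?num_real// -subr_ge0.
have -> : sqnormq p * sqnormq q - D ^+ 2 =
    (q0 p * q1 q - q1 p * q0 q) ^+ 2 + (q0 p * q2 q - q2 p * q0 q) ^+ 2 +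
    (q0 p * q3 q - q3 p * q0 q) ^+ 2 + (q1 p * q2 q - q2 p * q1 q) ^+ 2 +
    (q1 p * q3 q - q3 p * q1 q) ^+ 2 + (q2 p * q3 q - q3 p * q2 q) ^+ 2.
  by rewrite /sqnormq /D; ring.
by rewrite !addr_ge0 ?sqr_ge0.
Qed.

Lemma normqZ (a : R) q : normq (a *: q) = `|a| * normq q.
Proof.
rewrite /normq -sqrtr_sqr -sqrtrM ?sqr_ge0//; congr Num.sqrt.
by rewrite /sqnormq /=; ring.
Qed.

Lemma normq0_eq0 q : normq q = 0 -> q = 0.
Proof.
move=> /eqP; rewrite sqrtr_eq0 => q0.
by apply/eqP; rewrite -sqnormq_eq0 eq_le q0 sqnormq_ge0.
Qed.

HB.instance Definition _ := Lmodule_isNormed.Build R (quat R)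
  ler_normqD normqZ normq0_eq0.

End QuatRing.

(** * Imaginary units, the planes C_i, and the splitting H = C_i + C_i j *)

Section Slices.
Variable R : realType.
Implicit Types i j p q z w : quat R.

Definition usphere : set (quat R) := [set p | `|p| = 1].

Definition imag_unit : set (quat R) := [set q | q ^+ 2 = -1].

Definition orthogonal_units i j := i * j + j * i = 0.

Definition slice i : set (quat R) :=
  [set z | exists x y : R, z = x%:A + y *: i].

(* For q = z + w j with z, w in C_i one has i q i = - z + w j; this gives z and
   w in terms of q. *)
Definition slice_fst i q : quat R := 2^-1 *: (q - i * q * i).
Definition slice_snd i j q : quat R := - (2^-1 *: ((q + i * q * i) * j)).

Lemma slice_comm i z w : slice i z -> slice i w -> z * w = w * z.
Proof.
by move=> [x [y ->]] [x' [y' ->]]; apply: quatP => /=; ring.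
Qed.

Lemma orthogonal_unitsE i j : orthogonal_units i j -> j * i = - (i * j).
Proof. by move=> ij; apply/eqP; rewrite -addr_eq0 addrC ij. Qed.

Lemma comm_slice i z : imag_unit i -> i * z = z * i -> slice i z.
Proof.
move=> ii iz; exists (q0 z), (q1 z * q1 i + q2 z * q2 i + q3 z * q3 i).
have [ii0 ii1 ii2 ii3] : [/\
    q0 i * q0 i - q1 i * q1 i - q2 i * q2 i - q3 i * q3 i = -1,
    q0 i * q1 i = 0, q0 i * q2 i = 0 & q0 i * q3 i = 0].
  have e k := congr1 k ii; move: (e _ (@q0 R)) (e _ (@q1 R)) (e _ (@q2 R)) (e _ (@q3 R)).
  by rewrite expr2 /=; split; lra.
have i0 : q0 i = 0.
  apply/eqP; apply/negPn/negP => n0.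
  have := mulfI n0; move=> inj.
  have i1 : q1 i = 0 by apply: inj; rewrite ii1 mulr0.
  have i2 : q2 i = 0 by apply: inj; rewrite ii2 mulr0.
  have i3 : q3 i = 0 by apply: inj; rewrite ii3 mulr0.
  by move: ii0; rewrite i1 i2 i3; nra.
have [c1 c2 c3] : [/\ q2 i * q3 z = q3 i * q2 z, q3 i * q1 z = q1 i * q3 z
    & q1 i * q2 z = q2 i * q1 z].
  have e k := congr1 k iz; move: (e _ (@q1 R)) (e _ (@q2 R)) (e _ (@q3 R)) => /=.
  by split; lra.
have n1 : q1 i * q1 i + q2 i * q2 i + q3 i * q3 i = 1.
  by move: ii0; rewrite i0; lra.
apply: quatP => /=.
- by rewrite i0; ring.
- rewrite -[LHS]mulr1 -n1.
  transitivity (q1 i * q1 i * q1 z + q2 i * (q2 i * q1 z) + q3 i * (q3 i * q1 z)).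
    by ring.
  by rewrite c2 -c3; ring.
- rewrite -[LHS]mulr1 -n1.
  transitivity (q1 i * (q1 i * q2 z) + q2 i * q2 i * q2 z + q3 i * (q3 i * q2 z)).
    by ring.
  by rewrite c3 -c1; ring.
- rewrite -[LHS]mulr1 -n1.
  transitivity (q1 i * (q1 i * q3 z) + q2 i * (q2 i * q3 z) + q3 i * q3 i * q3 z).
    by ring.
  by rewrite c1 -c2; ring.
Qed.

Lemma slice_fstP i q : imag_unit i -> slice i (slice_fst i q).
Proof.
move=> ii; apply: comm_slice => //; rewrite /slice_fst -scalerAr -scalerAl.
congr (_ *: _); rewrite mulrBr mulrBl !mulrA -expr2 (ii : i ^+ 2 = -1).
by rewrite -(mulrA _ i i) -expr2 (ii : i ^+ 2 = -1) !mulNr mul1r mulrN1 !opprK addrC.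
Qed.

Lemma slice_sndP i j q : imag_unit i -> orthogonal_units i j ->
  slice i (slice_snd i j q).
Proof.
move=> ii /orthogonal_unitsE ij; apply: comm_slice => //.
rewrite /slice_snd mulrN mulNr -scalerAr -scalerAl.
congr (- (_ *: _)); rewrite -(mulrA _ j i) ij mulrN !mulrA -mulNr; congr (_ * j).
rewrite mulrDr mulrDl !mulrA -expr2 (ii : i ^+ 2 = -1) mulNr mul1r.
by rewrite -(mulrA _ i i) -expr2 (ii : i ^+ 2 = -1) mulrN1 opprD opprK mulNr addrC.
Qed.

Lemma half_double q : 2^-1 *: (q + q) = q.
Proof. by apply: quatP => /=; field. Qed.

Lemma slice_splitE i j q : imag_unit j ->
  q = slice_fst i q + slice_snd i j q * j.
Proof.
move=> jj; rewrite /slice_fst /slice_snd mulNr -scalerAl -(mulrA _ j j) -expr2.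
rewrite (jj : j ^+ 2 = -1) mulrN1 scalerN opprK -scalerDr addrACA addNr addr0.
by rewrite half_double.
Qed.

Lemma slice_split_uniq i j z w : imag_unit i -> imag_unit j ->
    orthogonal_units i j -> slice i z -> slice i w ->
  z = slice_fst i (z + w * j) /\ w = slice_snd i j (z + w * j).
Proof.
move=> ii jj /orthogonal_unitsE ij Sz Sw.
have Si : slice i i by exists 0, 1; rewrite scale0r add0r scale1r.
have e : i * (z + w * j) * i = - z + w * j.
  rewrite mulrDr mulrDl (slice_comm Si Sz) -mulrA -expr2 (ii : _ = -1) mulrN1.
  congr (_ + _); rewrite mulrA (slice_comm Si Sw) -!mulrA ij mulrN mulrA.
  by rewrite -expr2 (ii : _ = -1) mulN1r opprK.
split; rewrite /slice_fst /slice_snd e.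
  by rewrite opprD opprK addrACA subrr addr0 half_double.
rewrite addrACA subrr add0r -mulrDl.
by rewrite -mulrA -expr2 (jj : _ = -1) mulrN1 scalerN opprK half_double.
Qed.

End Slices.

(** * The quaternionic Wiener algebra *)

Section Wiener.
Variable R : realType.
Implicit Types (i j p z : quat R) (c d : int -> quat R) (f g : quat R -> quat R).

(* Sum over Z, as the limit of the partial sums over {-n, ..., n - 1}
   ([Negz k] is - k - 1). *)
Definition zsum c : quat R :=
  limn (series (fun k => c (Posz k) + c (Negz k))).

Definition laurent c p : quat R := zsum (fun u => p ^ u * c u).

Definition abs_summable c := summable [set: int] (fun u => `|c u|%:E).

(* Only the values of f on the unit sphere matter: elements of the algebra are
   functions on [usphere], represented by functions on H. *)
Definition expansion f : set (int -> quat R) :=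
  [set c | abs_summable c /\ forall p, usphere p -> f p = laurent c p].

Definition wiener : set (quat R -> quat R) := [set f | expansion f !=set0].

(* The coefficients of f, which are unique when f is in [wiener]. *)
Definition coef f : int -> quat R := get (expansion f).

Definition conv c d (u : int) : quat R := zsum (fun k => c (u - k) * d k).

Definition star f g : quat R -> quat R := laurent (conv (coef f) (coef g)).

Definition star_invertible f := exists g, [/\ wiener g,
  forall p, usphere p -> star f g p = 1 &
  forall p, usphere p -> star g f p = 1].

(* On C_i, [conjq] is complex conjugation. All entries of [omega i j f z] lie in
   the commutative field C_i when z does, so [\det (omega i j f z)] is then the
   usual determinant of a complex matrix. *)
Definition omega i j f z : 'M[quat R]_2 :=
  let a := laurent (fun u => slice_fst i (coef f u)) in
  let b := laurent (fun u => slice_snd i j (coef f u)) in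
  \matrix_(k < 2, l < 2)
    if k == 0 then (if l == 0 then a z else b z)
    else (if l == 0 then - conjq (b (conjq z)) else conjq (a (conjq z))).

End Wiener.

(* Main.v *)
Require Import Defs.
From mathcomp Require Import all_boot all_order all_algebra.
From mathcomp Require Import perm.
From mathcomp Require Import all_classical all_reals all_analysis.
From mathcomp Require Import ring lra zify.

(* Write a point of the unit sphere as p = cos t + I sin t with I^2 = -1; then
   f(p) = A + I B, where the quaternions A = sum_u cos(ut) f_u and
   B = sum_u sin(ut) f_u do not depend on I. Let
   x = |A|^2 - |B|^2 and y = 2 <A, B>. Then det omega(f)(cos t + i sin t) is
   x + y i, and x = y = 0 holds exactly when A + I B = 0 for some I (namely
   I = - A B^-1), which gives the equivalence of (ii) and (iii). At such a t
   the product f * g vanishes at the corresponding p, whatever g is, so (i)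
   implies (ii). Conversely, when h = x^2 + y^2 > 0, an inverse of f is the g
   with cosine part (x A~ + y B~) / h and sine part (x B~ - y A~) / h, where ~ is
   quaternionic conjugation; its components lie in the Wiener algebra as soon
   as 1 / h does.

   For this scalar Wiener lemma, scale h so that h = 1 - k with |k| < 1. A
   trigonometric polynomial of degree d bounded by K has Wiener norm at most
   (2d + 1) K, since it is its own discrete convolution with the Dirichlet
   kernel. Approximating k by such polynomials, the norm of k^m is bounded by
   (2md + 1) r^m for some r < 1, hence is < 1 for some m, and
   1 / (1 - k) = (1 + k + ... + k^(m-1)) / (1 - k^m) is given by a Neumann
   series. *)

Set Implicit Arguments.
Unset Strict Implicit.
Unset Printing Implicit Defensive.

Import Order.TTheory GRing.Theory Num.Theory.
Import numFieldNormedType.Exports.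

Local Open Scope classical_set_scope.
Local Open Scope ring_scope.

(** * Wiener's lemma for real trigonometric series *)

Section TrigSums.
Variable R : realType.
Implicit Types (s : seq (R * int * R)) (F G : R -> R) (t M : R).

(* The atom (r, u, phi) stands for the function r cos (u t + phi). *)
Definition tsum s t : R := \sum_(a <- s) a.1.1 * cos (a.1.2%:~R * t + a.2).
Definition tnorm s : R := \sum_(a <- s) `|a.1.1|.

(** The product formula [cos x cos y = (cos (x + y) + cos (x - y)) / 2], applied to every pair of
    atoms; the two halves of each weight keep [tnorm] exactly multiplicative. *)
Definition tmul s s' : seq (R * int * R) :=
  [seq (a.1.1 * b.1.1 / 2, a.1.2 + b.1.2, a.2 + b.2) | a <- s, b <- s'] ++
  [seq (a.1.1 * b.1.1 / 2, a.1.2 - b.1.2, a.2 - b.2) | a <- s, b <- s'].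

Lemma tsum_cat s s' t : tsum (s ++ s') t = tsum s t + tsum s' t.
Proof. by rewrite /tsum big_cat. Qed.

Lemma tnorm_cat s s' : tnorm (s ++ s') = tnorm s + tnorm s'.
Proof. by rewrite /tnorm big_cat. Qed.

Lemma tnorm_ge0 s : 0 <= tnorm s.
Proof. by apply: sumr_ge0. Qed.

Lemma tsum_mul s s' t : tsum (tmul s s') t = tsum s t * tsum s' t.
Proof.
rewrite tsum_cat /tsum !big_allpairs_dep -big_split /= mulr_suml.
apply: eq_bigr => a _; rewrite -big_split mulr_sumr /=; apply: eq_bigr => b _.
set x := _ * t + a.2; set y := _ * t + b.2.
rewrite intrD intrB (_ : _ * t + (a.2 + b.2) = x + y); last by rewrite /x /y; ring.
rewrite (_ : _ * t + (a.2 - b.2) = x - y); last by rewrite /x /y; ring.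
by rewrite cosD cosB; field.
Qed.

Lemma tnorm_mul s s' : tnorm (tmul s s') = tnorm s * tnorm s'.
Proof.
rewrite tnorm_cat /tnorm !big_allpairs_dep -big_split /= mulr_suml.
apply: eq_bigr => a _; rewrite -big_split mulr_sumr /=; apply: eq_bigr => b _.
by rewrite !normrM normfV (ger0_norm (@ler0n R 2)); field.
Qed.

Lemma normr_tsum_le s t : `|tsum s t| <= tnorm s.
Proof.
apply: (le_trans (ler_norm_sum _ _ _)); apply: ler_sum => a _.
by rewrite normrM ler_piMr// cos_max.
Qed.

Definition tconst (c : R) : seq (R * int * R) := [:: (c, 0, 0)].

Lemma tsum_const c t : tsum (tconst c) t = c.
Proof. by rewrite /tsum big_seq1 /= mul0r add0r cos0 mulr1. Qed.

Lemma tnorm_const c : tnorm (tconst c) = `|c|.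
Proof. by rewrite /tnorm big_seq1. Qed.

Definition tscale (c : R) s : seq (R * int * R) := [seq (c * a.1.1, a.1.2, a.2) | a <- s].

Lemma tsum_scale c s t : tsum (tscale c s) t = c * tsum s t.
Proof. by rewrite /tsum big_map mulr_sumr; apply: eq_bigr => a _; rewrite mulrA. Qed.

Lemma tnorm_scale c s : tnorm (tscale c s) = `|c| * tnorm s.
Proof. by rewrite /tnorm big_map mulr_sumr; apply: eq_bigr => a _; rewrite normrM. Qed.

(* The Wiener norm of F is at most M. Atoms may be repeated in S, so that no
   regrouping of coefficients is needed for products. *)
Definition wle F M := exists S : nat -> seq (R * int * R),
  (forall n, \sum_(m < n) tnorm (S m) <= M) /\
  forall t, (fun n => \sum_(m < n) tsum (S m) t) @ \oo --> F t.

Lemma wle_tsum s : wle (tsum s) (tnorm s).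
Proof.
exists (fun n => if n is 0%N then s else [::]); split=> [[|n]|t].
- by rewrite big_ord0 tnorm_ge0.
- by rewrite big_ord_recl big1 ?addr0// => k _; rewrite /tnorm big_nil.
- apply: cvg_near_cst; near=> n.
  have n0 : (0 < n)%N by near: n; exists 1%N.
  rewrite -(prednK n0) big_ord_recl big1 ?addr0// => k _.
  by rewrite /tsum big_nil.
Unshelve. all: by end_near. Qed.

Lemma wle_ext F G M : F =1 G -> wle F M -> wle G M.
Proof. by move=> /funext ->. Qed.

Lemma wle_le F M M' : M <= M' -> wle F M -> wle F M'.
Proof. by move=> h [S [b c]]; exists S; split=> // n; exact: le_trans h. Qed.

Lemma wle_ge0 F M : wle F M -> 0 <= M.
Proof. by move=> [S [/(_ 0%N)]]; rewrite big_ord0. Qed.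


Lemma wle_bound F M t : wle F M -> `|F t| <= M.
Proof.
move=> [S [b c]]; apply: (cvgr_to_le (cvg_norm (c t))).
near=> n; apply: le_trans (b n); apply: (le_trans (ler_norm_sum _ _ _)).
by apply: ler_sum => k _; exact: normr_tsum_le.
Unshelve. all: by end_near. Qed.

Lemma series_bounded_cvg (u : nat -> R) M :
  (forall n, \sum_(m < n) `|u m| <= M) -> cvgn (fun n => \sum_(m < n) u m).
Proof.
move=> b; have -> : (fun n => \sum_(m < n) u m) = series u.
  by apply/funext => n; rewrite /series /= big_mkord.
apply: normed_cvg.
have -> : [normed series u] = (fun n => \sum_(m < n) `|u m|).
  by apply/funext => n; rewrite -(big_mkord xpredT (fun m => `|u m|)).
apply: nondecreasing_is_cvgn; last by exists M => _ [n _ <-]; exact: b.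
by apply/nondecreasing_seqP => n; rewrite big_ord_recr/= lerDl.
Qed.

(** The index [n0] is one where the partial sum is within [e] of the supremum; every later block
    fits in the remaining gap. *)
Lemma series_bounded_tail (u : nat -> R) M e :
  (forall n, 0 <= u n) -> (forall n, \sum_(m < n) u m <= M) -> 0 < e ->
  exists n0, forall n, \sum_(m < n) u (n0 + m)%N <= e.
Proof.
move=> u0 b e0.
have nd : nondecreasing_seq (fun n => \sum_(m < n) u m).
  by apply/nondecreasing_seqP => n; rewrite big_ord_recr /= lerDl.
have ub : has_ubound (range (fun n => \sum_(m < n) u m)).
  by exists M => _ [n _ <-]; exact: b.
have cv := nondecreasing_cvgn nd ub; set L := sup _ in cv.
have [n0 _ hn0] := (cvgrPdist_le _ _).1 cv e e0.
exists n0 => n; have := hn0 n0 (leqnn _).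
have le n' : \sum_(m < n') u m <= L.
  by apply: ub_le_sup => //; exists n'.
rewrite /= ger0_norm ?subr_ge0 ?le// => h; have := le (n0 + n)%N.
by rewrite big_split_ord /=; lra.
Qed.

(** A partial sum kept as a single list of atoms, so that it can be a factor of [tmul]. *)
Fixpoint tcats (S : nat -> seq (R * int * R)) n :=
  if n is n'.+1 then tcats S n' ++ S n' else [::].

Lemma tsum_cats S n t : tsum (tcats S n) t = \sum_(m < n) tsum (S m) t.
Proof.
elim: n => [|n IH]; first by rewrite big_ord0 /tsum big_nil.
by rewrite big_ord_recr /= tsum_cat IH.
Qed.

Lemma tnorm_cats S n : tnorm (tcats S n) = \sum_(m < n) tnorm (S m).
Proof.
elim: n => [|n IH]; first by rewrite big_ord0 /tnorm big_nil.
by rewrite big_ord_recr /= tnorm_cat IH.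
Qed.

(** Trigonometric polynomials are dense for the Wiener norm: cut the series where the tail of its
    norms falls below [e]. *)
Lemma wle_split F M e : wle F M -> 0 < e ->
  exists s G, wle G e /\ forall t, F t = tsum s t + G t.
Proof.
move=> [S [b c]] e0.
have [n0 hn0] := series_bounded_tail (fun n => tnorm_ge0 (S n)) b e0.
exists (tcats S n0), (fun t => F t - tsum (tcats S n0) t); split; last first.
  by move=> t; rewrite addrCA subrr addr0.
exists (fun n => S (n0 + n)%N); split=> // t.
have -> : (fun n => \sum_(m < n) tsum (S (n0 + m)%N) t) =
    (fun n => \sum_(m < (n + n0)%N) tsum (S m) t - tsum (tcats S n0) t).
  by apply/funext => n; rewrite addnC big_split_ord /= tsum_cats addrAC subrr add0r.
apply: cvgB; last exact: cvg_cst.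
by have := c t; rewrite -(cvg_shiftn n0).
Qed.

Lemma wleD F G M N : wle F M -> wle G N -> wle (fun t => F t + G t) (M + N).
Proof.
move=> [S [bS cS]] [T [bT cT]]; exists (fun n => S n ++ T n); split=> [n|t].
  under eq_bigr do rewrite tnorm_cat.
  by rewrite big_split lerD.
under eq_fun do under eq_bigr do rewrite tsum_cat.
by under eq_fun do rewrite big_split; apply: cvgD.
Qed.

Lemma wleZ c F M : wle F M -> wle (fun t => c * F t) (`|c| * M).
Proof.
move=> [S [bS cS]]; exists (fun n => tscale c (S n)); split=> [n|t].
  under eq_bigr do rewrite tnorm_scale.
  by rewrite -mulr_sumr ler_wpM2l.
under eq_fun do under eq_bigr do rewrite tsum_scale.
by under eq_fun do rewrite -mulr_sumr; apply: cvgM => //; exact: cvg_cst.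
Qed.

Lemma wle_const c : wle (fun=> c) `|c|.
Proof.
rewrite -tnorm_const; apply: wle_ext (wle_tsum _) => t.
by rewrite tsum_const.
Qed.

Lemma wleM F G M N : wle F M -> wle G N -> wle (fun t => F t * G t) (M * N).
Proof.
move=> [S [bS cS]] [T [bT cT]].
(* With [P_n] and [Q_n] the partial sums of the two series, [U n] represents the increment [P_(n+1)
   Q_(n+1) - P_n Q_n = S_n Q_(n+1) + P_n T_n]. *)
pose U n := tmul (S n) (tcats T n.+1) ++ tmul (tcats S n) (T n).
(* Evaluation at a point and [tnorm] are both additive on [++] and multiplicative on [tmul], so one
   computation with an abstract [ev] serves for values and for norms. *)
have UE (ev : seq (R * int * R) -> R) : ev [::] = 0 ->
    (forall s s', ev (s ++ s') = ev s + ev s') ->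
    (forall s s', ev (tmul s s') = ev s * ev s') ->
    forall n, \sum_(m < n) ev (U m) = ev (tcats S n) * ev (tcats T n).
  move=> ev0 evD evM; elim=> [|n IH]; first by rewrite big_ord0 /= ev0 mul0r.
  have -> : \sum_(m < n.+1) ev (U m) = ev (tcats S n) * ev (tcats T n) +
      (ev (S n) * ev (tcats T n.+1) + ev (tcats S n) * ev (T n)).
    by rewrite big_ord_recr /= IH /U evD; congr (_ + (_ + _)); exact: evM.
  by rewrite /= !evD; ring.
exists U; split=> [n|t].
  rewrite (UE tnorm) ?tnorm_cats; last 3 first.
  - by rewrite /tnorm big_nil.
  - exact: tnorm_cat.
  - exact: tnorm_mul.
  by apply: ler_pM => //; apply: sumr_ge0 => k _; exact: tnorm_ge0.
rewrite (_ : (fun n => _) =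
    (fun n => (\sum_(m < n) tsum (S m) t) * (\sum_(m < n) tsum (T m) t))).
  exact: cvgM.
apply/funext => n; rewrite (UE (tsum^~ t)) ?tsum_cats//.
- by rewrite /tsum big_nil.
- by move=> s s'; exact: tsum_cat.
- by move=> s s'; exact: tsum_mul.
Qed.

Lemma wleX F M n : wle F M -> wle (fun t => F t ^+ n) (M ^+ n).
Proof.
move=> wF; elim: n => [|n IH].
  by rewrite expr0 -[X in wle _ X]normr1; exact: wle_const.
by rewrite exprS; under eq_fun do rewrite exprS; exact: wleM.
Qed.

(* The partial sums satisfy G_{n+1} = 1 + K_n G_n, K_n the n-th partial sum of
   S, both for values and for norms; D_n represents G_{n+1} - G_n. *)
Fixpoint neumann (S : nat -> seq (R * int * R)) n :=
  if n is n'.+1 then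
    let G := (neumann S n').1 ++ (neumann S n').2 in
    (G, tmul (tcats S n') (neumann S n').2 ++ tmul (S n') G)
  else ([::], tconst 1).

Lemma neumannE S (ev : seq (R * int * R) -> R) : ev [::] = 0 -> ev (tconst 1) = 1 ->
    (forall s s', ev (s ++ s') = ev s + ev s') ->
    (forall s s', ev (tmul s s') = ev s * ev s') ->
  forall n, ev (neumann S n).1 = \sum_(m < n) ev (neumann S m).2 /\
    ev (neumann S n.+1).1 = 1 + ev (tcats S n) * ev (neumann S n).1.
Proof.
move=> ev0 ev1 evD evM; elim=> [|n [IH1 IH2]].
  by rewrite big_ord0 /= ev0 mul0r addr0 ev1.
split; first by rewrite big_ord_recr /= evD IH1.
set H := neumann S n.+1 in IH2 *.
have -> : ev (neumann S n.+2).1 = ev H.1 + ev H.2 by rewrite /= -/H evD.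
have -> : ev H.2 = ev (tcats S n) * ev (neumann S n).2 + ev (S n) * ev H.1.
  by rewrite /H /= evD !evM.
have e : ev H.1 = ev (neumann S n).1 + ev (neumann S n).2 by rewrite /H /= evD.
rewrite (_ : ev (tcats S n.+1) = ev (tcats S n) + ev (S n)); last by rewrite /= evD.
by rewrite {1}IH2 e; ring.
Qed.

Lemma wle_neumann F q : wle F q -> q < 1 ->
  exists G M, wle G M /\ forall t, (1 - F t) * G t = 1.
Proof.
move=> wF q1; have q0 := wle_ge0 wF; case: (wF) => S [bS cS].
have EV t := @neumannE S (tsum^~ t) (big_nil _ _ _ _) (tsum_const 1 t)
  (fun s s' => tsum_cat s s' t) (fun s s' => tsum_mul s s' t).
have EN := @neumannE S tnorm (big_nil _ _ _ _)
  (etrans (tnorm_const 1) (normr1 _)) tnorm_cat tnorm_mul.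
(* The norms satisfy [g_{n+1} <= 1 + q g_n] with [g_0 = 0], and [(1 - q)^-1] is the fixed point of
   [x -> 1 + q x]. *)
have bG n : \sum_(m < n) tnorm (neumann S m).2 <= (1 - q)^-1.
  rewrite -(EN n).1; elim: n => [|n IH].
    by rewrite /tnorm big_nil invr_ge0 subr_ge0 ltW.
  rewrite (EN n).2; apply: (@le_trans _ _ (1 + q * (1 - q)^-1)).
    by rewrite lerD2l ler_pM ?tnorm_ge0// tnorm_cats.
  by rewrite le_eqVlt; apply/orP; left; apply/eqP; field; lra.
pose G t := limn (fun n => \sum_(m < n) tsum (neumann S m).2 t).
have cG t : (fun n => \sum_(m < n) tsum (neumann S m).2 t) @ \oo --> G t.
  apply: (@series_bounded_cvg (fun m => tsum (neumann S m).2 t) (1 - q)^-1) => n.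
  apply: le_trans (bG n).
  by apply: ler_sum => m _; exact: normr_tsum_le.
exists G, (1 - q)^-1; split; first by exists (fun n => (neumann S n).2).
move=> t; rewrite mulrBl mul1r; apply/eqP; rewrite subr_eq; apply/eqP.
have c1 : (fun n => \sum_(m < n.+1) tsum (neumann S m).2 t) @ \oo --> G t.
  have := cG t; rewrite -(cvg_shiftS (fun n => \sum_(m < n) tsum (neumann S m).2 t)).
  exact.
(* Both sides of [G_{n+1} = 1 + K_n G_n] converge; the limit is [G t = 1 + F t * G t]. *)
apply: (cvg_unique _ c1) => //=.
rewrite (_ : (fun n => _) = (fun n => 1 + (\sum_(m < n) tsum (S m) t) *
    (\sum_(m < n) tsum (neumann S m).2 t))).
  by apply: cvgD; [exact: cvg_cst | exact: cvgM].
by apply/funext => n; rewrite -(EV t n.+1).1 (EV t n).2 (EV t n).1 tsum_cats.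
Qed.

(** The Wiener norm dominates the sup norm, so [F] is uniformly within [e / 3] of a trigonometric
    polynomial. *)
Lemma wle_continuous F M : wle F M -> continuous F.
Proof.
move=> wF x; apply/cvgrPdist_lt => e e0.
have e30 : 0 < e / 3 by lra.
have [s [G [wG FE]]] := wle_split wF e30.
have cs : continuous (tsum s).
  elim: (s) => [|a s' IH].
    have -> : tsum [::] = fun=> 0 by apply/funext => t; rewrite /tsum big_nil.
    by move=> y; exact: cvg_cst.
  have -> : tsum (a :: s') = fun t => a.1.1 * cos (a.1.2%:~R * t + a.2) + tsum s' t.
    by apply/funext => t; rewrite /tsum big_cons.
  move=> y; apply: cvgD; last exact: IH.
  apply: cvgM; first exact: cvg_cst.
  apply: (@cvg_comp _ _ _ (fun t => a.1.2%:~R * t + a.2) cos); last exact: continuous_cos.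
  by apply: cvgD; [apply: cvgM; [exact: cvg_cst | exact: cvg_id] | exact: cvg_cst].
have /cvgrPdist_lt /(_ _ e30) := cs x; apply: filterS => y h.
rewrite /= !FE (_ : _ - _ = (tsum s x - tsum s y) + G x - G y); last by ring.
have := wle_bound x wG; have := wle_bound y wG; move: h.
rewrite !ltr_norml !ler_norml; lra.
Qed.

(** * Discrete orthogonality of cosines and interpolation at equidistant nodes *)

Lemma sum_cos_eq0 N (w : int) (psi : R) : 0 < `|w| < N%:Z ->
  \sum_(k < N) cos (w%:~R * (k%:R * (2 * pi / N%:R)) + psi) = 0.
Proof.
move=> /andP[w0 wN].
have N0 : (0 < N)%N by lia.
have N0' : N%:R != 0 :> R by rewrite pnatr_eq0 -lt0n.
pose al : R := w%:~R * (2 * pi / N%:R).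
(* The number [al] is the step between consecutive angles; the absolute value of its half,
   [|w| pi / N], lies strictly between 0 and pi. *)
have s0 : sin (al / 2) != 0.
  have -> : al / 2 = Num.sg w%:~R * (`|w%:~R| * pi / N%:R).
    by rewrite /al {1}[w%:~R]numEsg; field.
  rewrite sin_sg; apply: mulf_neq0; first by rewrite sgr_eq0 intr_eq0 -normr_gt0.
  apply: lt0r_neq0; apply: sin_gt0_pi; rewrite -intr_norm.
  have pi0 := pi_gt0 R; have n0 : 0 < N%:R :> R by rewrite ltr0n.
  rewrite divr_gt0 ?mulr_gt0 ?ltr0z//= ltr_pdivrMr// mulrC ltr_pM2l//.
  by rewrite -[N%:R]/(N%:Z%:~R) ltr_int.
apply: (mulfI s0); rewrite mulr0 mulr_sumr.
(* After multiplication by [sin (al / 2)] the k-th term is [S k.+1 - S k]; the sum telescopes to two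
   sines whose angles differ by [2 pi w]. *)
pose S k := sin ((k%:R - 2^-1) * al + psi) / 2.
rewrite (eq_bigr (fun k : 'I_N => S k.+1 - S k)); last first.
  move=> k _; rewrite /S -[k.+1%:R]natr1 (_ : (_ + 1 - _) * al + psi = (k%:R * al + psi) + al / 2); last by field.
  rewrite (_ : (_ - _) * al + psi = (k%:R * al + psi) - al / 2); last by field.
  rewrite (_ : _ + psi = k%:R * al + psi); last by rewrite /al; ring.
  by rewrite sinD sinB; field.
rewrite -(big_mkord xpredT (fun k => S k.+1 - S k)) telescope_sumr// /S.
rewrite -mulrBl (_ : (N%:R - 2^-1) * al + psi = (0%:R - 2^-1) * al + psi + pi *+ 2 *~ w); last first.
  by rewrite -mulrzr /al -mulr_natl; field.
suff sinP (x : R) : sin (x + pi *+ 2 *~ w) = sin x by rewrite sinP subrr mul0r.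
case: w {w0 wN al s0 S} => n; rewrite ?NegzE ?mulrNz -pmulrn.
  exact: (periodicn (@sinD2pi R)).
by rewrite -[in RHS](subrK (pi *+ 2 *+ n.+1) x) (periodicn (@sinD2pi R)).
Qed.

Lemma mean_cos N (w : int) (psi : R) : (0 < N)%N -> `|w| < N%:Z ->
  N%:R^-1 * \sum_(k < N) cos (w%:~R * (k%:R * (2 * pi / N%:R)) + psi) =
  if w == 0 then cos psi else 0.
Proof.
move=> N0 wN; case: eqVneq => [->|w0]; last by rewrite sum_cos_eq0 ?mulr0// normr_gt0 w0.
rewrite (eq_bigr (fun=> cos psi)) => [|k _]; last by rewrite mul0r add0r.
by rewrite sumr_const card_ord -[X in _ * X]mulr_natl mulKf// pnatr_eq0 -lt0n.
Qed.

Definition tdeg d s := all (fun a => (`|a.1.2| <= d)%N) s.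

Definition tnode d k : R := k%:R * (2 * pi / (d.*2.+1)%:R).

Lemma tnode_itv d k : (k < d.*2.+1)%N -> 0 <= tnode d k <= 2 * pi.
Proof.
move=> kd; have pi0 : 0 <= 2 * pi :> R by have := pi_gt0 R; lra.
have k1 : 0 <= (k%:R : R) / d.*2.+1%:R <= 1.
  by rewrite divr_ge0 ?ler0n//= ler_pdivrMr ?ltr0n// mul1r ler_nat ltnW.
have -> : tnode d k = 2 * pi * (k%:R / d.*2.+1%:R) by rewrite /tnode mulrCA.
by case/andP: k1 => k0 k1; rewrite mulr_ge0//= ler_piMr.
Qed.

(* Discrete convolution with the Dirichlet kernel reproduces trigonometric
   polynomials of degree d. *)
Lemma tsum_interp d s t : tdeg d s ->
  \sum_(v < d.*2.+1) \sum_(k < d.*2.+1) (d.*2.+1)%:R^-1 * tsum s (tnode d k) *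
    cos ((v%:Z - d%:Z)%:~R * (t - tnode d k)) = tsum s t.
Proof.
set N := d.*2.+1 => /allP ds.
rewrite exchange_big /= /tsum.
under eq_bigr do under eq_bigr do rewrite mulr_sumr mulr_suml.
under eq_bigr do rewrite exchange_big /=.
rewrite exchange_big /= big_seq [RHS]big_seq; apply: eq_bigr => -[[r u] ph] /ds /= {}ds.
rewrite exchange_big /=.
(* For an atom of frequency [u] and the kernel frequency [w = v - d], the product formula produces
   the frequencies [u - w] and [u + w], both at most [2 d < N] in absolute value. By [mean_cos] only
   [w = u] and [w = - u] survive, each giving half of the atom. *)
have step (v : 'I_N) : \sum_(k < N) N%:R^-1 *
      (r * cos (u%:~R * tnode d k + ph)) *
      cos ((v%:Z - d%:Z)%:~R * (t - tnode d k)) =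
    r / 2 * ((if v%:Z == d%:Z + u then cos (u%:~R * t + ph) else 0) +
    (if v%:Z == d%:Z - u then cos (u%:~R * t + ph) else 0)).
  pose w : int := v%:Z - d%:Z; rewrite -/w.
  transitivity (r / 2 * (N%:R^-1 * \sum_(k < N) cos ((u - w)%:~R * tnode d k + (ph + w%:~R * t)) +
       N%:R^-1 * \sum_(k < N) cos ((u + w)%:~R * tnode d k + (ph - w%:~R * t)))).
    rewrite -mulrDr -big_split /= 2!mulr_sumr; apply: eq_bigr => k _.
    rewrite intrB intrD; set x := u%:~R * tnode d k + ph; set y := w%:~R * (t - tnode d k).
    rewrite (_ : _ + (ph + _) = x + y); last by rewrite /x /y; ring.
    rewrite (_ : _ + (ph - _) = x - y); last by rewrite /x /y; ring.
    by clearbody x y; rewrite cosD cosB; move: (N%:R^-1) => c; field.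
  have vN : (v < d.*2.+1)%N by exact: ltn_ord.
  have w1 : `|u - w| < N%:Z by rewrite /w; move: ds vN; rewrite /N; lia.
  have w2 : `|u + w| < N%:Z by rewrite /w; move: ds vN; rewrite /N; lia.
  rewrite !mean_cos//.
  have -> : (u - w == 0) = (v%:Z == d%:Z + u) by rewrite /w; lia.
  have -> : (u + w == 0) = (v%:Z == d%:Z - u) by rewrite /w; lia.
  congr (_ * (_ + _)); case: eqP => // e; congr cos.
    have -> : w = u by rewrite /w; lia.
    by rewrite addrC.
  have -> : w = - u by rewrite /w; lia.
  by rewrite intrN; ring.
rewrite (eq_bigr _ (fun v _ => step v)) -mulr_sumr big_split /=.
have one (z : int) (x : R) : 0 <= z < N%:Z -> \sum_(v < N) (if v%:Z == z then x else 0) = x.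
  move=> hz; have h : (`|z| < N)%N by lia.
  rewrite (bigD1 (Ordinal h)) //= big1 ?addr0 => [|k]; first by case: eqP => // ?; lia.
  by move=> nk; case: eqP => // e; move/eqP: nk => []; apply: val_inj => /=; lia.
by rewrite !one; [field | rewrite /N; lia ..].
Qed.

Lemma sum_iota n (E : nat -> R) : \sum_(v <- iota 0 n) E v = \sum_(v < n) E v.
Proof. by rewrite -(big_mkord xpredT E) /index_iota subn0. Qed.

(** With [N = 2 d + 1], the interpolation formula rewrites the polynomial with [N * N] atoms, each
    of weight at most [K / N]; their total is [N * K], however large [tnorm s] was. *)
Lemma wle_sup d s K : tdeg d s ->
  (forall t, 0 <= t <= 2 * pi -> `|tsum s t| <= K) ->
  wle (tsum s) ((d.*2.+1)%:R * K).
Proof.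
move=> ds hK; pose D N := [seq (N%:R^-1 * tsum s (tnode d k), v%:Z - d%:Z,
  - ((v%:Z - d%:Z)%:~R * tnode d k)) | v <- iota 0 N, k <- iota 0 N].
apply: (@wle_le _ (tnorm (D d.*2.+1))); last first.
  apply: wle_ext (wle_tsum _) => t; rewrite -(tsum_interp t ds); move: d.*2.+1 => N.
  rewrite {1}/tsum /D big_allpairs_dep /= sum_iota; apply: eq_bigr => v _.
  rewrite sum_iota; apply: eq_bigr => k _.
  by congr (_ * cos _); ring.
have N0 : d.*2.+1%:R != 0 :> R by rewrite pnatr_eq0.
have hN (k : 'I_d.*2.+1) : `|tsum s (tnode d k)| <= K by rewrite hK// tnode_itv.
move: (d.*2.+1) N0 hN => N N0 hN.
rewrite /tnorm /D big_allpairs_dep /= sum_iota.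
have cst (c : R) : \sum_(v < N) c = N%:R * c by rewrite sumr_const card_ord mulr_natl.
rewrite -cst; apply: ler_sum => v _.
rewrite sum_iota -[leRHS](mulKf N0) mulrCA -cst; apply: ler_sum => k _.
by rewrite normrM ger0_norm ?invr_ge0 ?ler0n// ler_wpM2l ?invr_ge0 ?ler0n.
Qed.

(** * Wiener norms of high powers and the scalar Wiener lemma *)

Definition tpow s n := iter n (tmul s) (tconst 1).

Lemma tsum_pow s n t : tsum (tpow s n) t = tsum s t ^+ n.
Proof. by elim: n => [|n IH]; rewrite ?tsum_const// /= tsum_mul IH exprS. Qed.

Lemma tdeg_pow d s n : tdeg d s -> tdeg (n * d) (tpow s n).
Proof.
move=> /allP ds; elim: n => [|n /allP IH]; first by rewrite /tdeg /= .
apply/allP => x /=; rewrite mem_cat => /orP[] /allpairsP[[a b] /= [/ds ha /IH hb ->]] /=; lia.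
Qed.

Lemma tdegP s : exists d, tdeg d s.
Proof.
exists (\sum_(a <- s) `|a.1.2|)%N; apply/allP => a sa.
by rewrite (perm_big _ (perm_to_rem sa)) big_cons leq_addr.
Qed.

(** Writing [P] for the polynomial and [F = P + G], one factor is expanded at a time:
    [P^l F^(m+1) = P^(l+1) F^m + G P^l F^m]. The exponent [l] is there for this induction, and
    [wle_sup] for [P^l] is its base. The degree contributes only a factor linear in [l + m]. *)
Lemma wle_pow_tsumD d s K G e l m : tdeg d s ->
  (forall t, 0 <= t <= 2 * pi -> `|tsum s t| <= K) -> 0 <= K -> wle G e ->
  wle (fun t => tsum s t ^+ l * (tsum s t + G t) ^+ m)
    ((((l + m) * d).*2.+1)%:R * K ^+ l * (K + e) ^+ m).
Proof.
move=> ds hK K0 wG; have e0 := wle_ge0 wG.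
elim: m l => [|m IH] l.
  rewrite addn0 expr0 mulr1; apply: wle_ext (_ : wle (tsum (tpow s l)) _) => [t|].
    by rewrite expr0 mulr1 tsum_pow.
  apply: wle_sup (tdeg_pow l ds) _ => t t2.
  by rewrite tsum_pow normrX lerXn2r ?nnegrE// hK.
have h1 := IH l.+1; have h2 := wleM wG (IH l).
apply: (wle_ext _ (wle_le _ (wleD h1 h2))) => [t|]; first by rewrite !exprS; ring.
(* [C] is the degree factor of both the goal and [h1]; [C'], that of [h2], is smaller. *)
rewrite addSnnS; set C := _%:R; set C' := _%:R.
have CC : C' <= C by rewrite ler_nat /C ltnS leq_double leq_mul2r leq_add2l leqnSn orbT.
apply: (@le_trans _ _ (C * K ^+ l.+1 * (K + e) ^+ m + e * (C * K ^+ l * (K + e) ^+ m))).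
  rewrite lerD2l ler_wpM2l// ler_wpM2r ?exprn_ge0 ?addr_ge0//.
  by rewrite ler_wpM2r ?exprn_ge0.
by rewrite !exprS le_eqVlt; apply/orP; left; apply/eqP; ring.
Qed.

(** With [1 + eta = tau^(-1/2)], squaring Bernoulli's inequality gives [tau^(-m) >= (1 + m eta)^2],
    which is quadratic in [m] and so overtakes [2 m d + 1]. *)
Lemma linear_lt_geometric d (tau : R) : 0 < tau < 1 ->
  exists m, ((m * d).*2.+1)%:R * tau ^+ m < 1.
Proof.
move=> /andP[t0 t1]; pose nu : R := Num.sqrt tau.
have nu0 : 0 < nu by rewrite sqrtr_gt0.
have nu1 : nu < 1 by rewrite -sqrtr1 ltr_sqrt.
pose eta : R := nu^-1 - 1.
have eta0 : 0 < eta by rewrite subr_gt0 invf_gt1.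
have bern n : 1 + n%:R * eta <= (1 + eta) ^+ n.
  elim: n => [|n IH]; first by rewrite mul0r addr0.
  rewrite exprS -natr1; have : 0 <= n%:R * eta ^+ 2 by rewrite mulr_ge0 ?ler0n ?sqr_ge0.
  have : (1 + eta) * (1 + n%:R * eta) <= (1 + eta) * (1 + eta) ^+ n by rewrite ler_wpM2l//; lra.
  by rewrite expr2; lra.
(* Such an [m] makes [m^2 eta^2] exceed [2 m d]. *)
have [m hm] : exists m : nat, 2 * d%:R / eta ^+ 2 < m%:R.
  exists (Num.bound (2 * d%:R / eta ^+ 2)); apply: archi_boundP.
  by rewrite divr_ge0 ?sqr_ge0// mulr_ge0 ?ler0n.
have m0 : 0 < m%:R :> R by apply: le_lt_trans hm; rewrite divr_ge0 ?sqr_ge0// mulr_ge0 ?ler0n.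
exists m.
have -> : tau ^+ m = ((1 + eta) ^+ m) ^- 2.
  rewrite /eta addrCA subrr addr0 exprVn exprVn invrK -exprM mulnC exprM sqr_sqrtr//.
  exact: ltW.
have B := bern m; have B0 : 0 < (1 + eta) ^+ m by rewrite exprn_gt0// addr_gt0.
rewrite ltr_pdivrMr; last by rewrite exprn_gt0.
rewrite mul1r -[_.+1%:R]natr1 -mul2n !natrM.
rewrite ltr_pdivrMr ?exprn_gt0// in hm.
have : (1 + m%:R * eta) ^+ 2 <= ((1 + eta) ^+ m) ^+ 2.
  by rewrite lerXn2r// nnegrE; [rewrite addr_ge0 ?mulr_ge0 ?ltW | exact: ltW].
apply: lt_le_trans; have : m%:R * (2 * d%:R) < m%:R * (m%:R * eta ^+ 2) by rewrite ltr_pM2l.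
have : 0 < m%:R * eta by rewrite mulr_gt0.
by rewrite !expr2; lra.
Qed.

Lemma wle_pow_lt1 F M rho : wle F M ->
  (forall t, 0 <= t <= 2 * pi -> `|F t| <= rho) -> rho < 1 ->
  exists m q, q < 1 /\ wle (fun t => F t ^+ m) q.
Proof.
move=> wF hF r1; have pi0 := pi_gt0 R.
have r0 : 0 <= rho by apply: le_trans (hF 0 _) => //; lra.
(* The polynomial part is bounded by [rho + e] and the remainder has norm at most [e]; the choice of
   [e] makes [rho + 2 e = (1 + rho) / 2 < 1]. *)
pose e : R := (1 - rho) / 4; have e0 : 0 < e by rewrite /e; lra.
have [s [G [wG FE]]] := wle_split wF e0.
have [d ds] := tdegP s.
have hs t : 0 <= t <= 2 * pi -> `|tsum s t| <= rho + e.
  move=> ht; have -> : tsum s t = F t - G t by rewrite FE addrK.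
  by apply: (le_trans (ler_normB _ _)); rewrite lerD ?hF ?(wle_bound _ wG).
have [|m hm] := @linear_lt_geometric d (rho + e + e); first by rewrite /e; lra.
exists m, (((m * d).*2.+1)%:R * (rho + e + e) ^+ m); split=> //.
have re0 : 0 <= rho + e by lra.
have := @wle_pow_tsumD d s (rho + e) G e 0 m ds hs re0 wG.
by rewrite add0n mulr1; apply: wle_ext => t; rewrite mul1r FE.
Qed.

(** Positivity on one period suffices for an inverse at every real [t]: the sup norm enters only
    through the interpolation nodes, which lie in [[0, 2 pi]]. *)
Theorem wiener_lemma F M : wle F M -> (forall t, 0 <= t <= 2 * pi -> 0 < F t) ->
  exists G N, wle G N /\ forall t, F t * G t = 1.
Proof.
move=> wF Fpos; have pi0 := pi_gt0 R.
have [c c2 cmin] : exists2 c, c \in `[0, 2 * pi]%R &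
    forall t, t \in `[0, 2 * pi]%R -> F c <= F t.
  apply: EVT_min; first by lra.
  by apply: continuous_subspaceT => x; exact: wle_continuous wF x.
have d0 : 0 < F c by apply: Fpos; move: c2; rewrite in_itv.
have FM t : `|F t| <= M by exact: wle_bound wF.
have M0 : 0 < M by apply: lt_le_trans d0 (le_trans (ler_norm _) (FM c)).
(* On the period [F c <= F t <= M], hence [0 <= k t <= 1 - F c / M < 1]. *)
pose k t := 1 + (- M^-1) * F t.
have wk := wleD (wle_const 1) (wleZ (- M^-1) wF).
have hk t : 0 <= t <= 2 * pi -> `|k t| <= 1 - F c / M.
  move=> ht; have h1 : F c <= F t by apply: cmin; rewrite in_itv.
  have h2 : F t <= M := le_trans (ler_norm _) (FM t).
  have h3 : F c / M <= F t / M by rewrite ler_pM2r ?invr_gt0.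
  have h4 : F t / M <= 1 by rewrite ler_pdivrMr ?mul1r.
  by rewrite /k mulNr mulrC ger0_norm; lra.
have k1 : 1 - F c / M < 1 by have : 0 < F c / M := divr_gt0 d0 M0; lra.
have [m [q [q1 wkm]]] := wle_pow_lt1 wk hk k1.
have [H [N [wH HE]]] := wle_neumann wkm q1.
have [N' wN'] : exists N', wle (fun t => \sum_(l < m) k t ^+ l) N'.
  elim: (m) => [|n [N' IH]].
    by exists `|0 : R|; apply: wle_ext (wle_const 0) => t; rewrite big_ord0.
  by eexists; under eq_fun do rewrite big_ord_recr; apply: wleD IH (wleX n wk).
exists (fun t => M^-1 * ((\sum_(l < m) k t ^+ l) * H t)); eexists; split.
  exact: wleZ (wleM wN' wH).
move=> t; rewrite -[RHS](HE t) -/(k t).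
have -> : 1 - k t ^+ m = (1 - k t) * \sum_(l < m) k t ^+ l.
  rewrite -[X in X - _](expr1n _ m) subrXX; congr (_ * _).
  by apply: eq_bigr => l _; rewrite expr1n mul1r.
by rewrite {2}/k; ring.
Qed.

End TrigSums.

(** * Summation over the integers *)

Section Tannery.
Variables (R : realType) (V : normedModType R).

Lemma cvg_sum_ord n (F : nat -> nat -> V) (l : nat -> V) :
  (forall m, F ^~ m @ \oo --> l m) ->
  (fun N => \sum_(m < n) F N m) @ \oo --> \sum_(m < n) l m.
Proof.
move=> h; elim: n => [|n IH].
  by under eq_fun do rewrite big_ord0; rewrite big_ord0; exact: cvg_cst.
under eq_fun do rewrite big_ord_recr /=.
by rewrite big_ord_recr /=; apply: cvgD.
Qed.

Lemma eq_cvg_seq (f g : nat -> V) (l : V) :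
  f =1 g -> f @ \oo --> l -> g @ \oo --> l.
Proof. by move=> /funext ->. Qed.

(** Dominated convergence for series: [mu] is a summable bound uniform in [N], so the limit in [N]
    may be taken term by term. *)
Lemma tannery (F : nat -> nat -> V) (mu : nat -> R) M (y sigma : nat -> V) (l : V) :
  (forall N m, `|F N m| <= mu m) -> (forall n, \sum_(m < n) mu m <= M) ->
  (forall m, F ^~ m @ \oo --> y m) ->
  (forall N, (fun n => \sum_(m < n) F N m) @ \oo --> sigma N) ->
  (fun n => \sum_(m < n) y m) @ \oo --> l ->
  sigma @ \oo --> l.
Proof.
move=> Fmu muM Fy Fsig yl; apply/cvgrPdist_le => e e0.
have mu0 m : 0 <= mu m by exact: le_trans (Fmu 0 m).
have e30 : 0 < e / 3 by lra.
have [n0 tl] := series_bounded_tail mu0 muM e30.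
(* Since [n0] depends on [mu] alone, truncation there costs at most [e / 3] for every row [F N] and
   for the limit row [y]. *)
have tail (x : nat -> V) z : (forall m, `|x m| <= mu m) ->
    (fun n => \sum_(m < n) x m) @ \oo --> z -> `|z - \sum_(m < n0) x m| <= e / 3.
  move=> xmu xz.
  have cv : (fun n => `|\sum_(m < n + n0) x m - \sum_(m < n0) x m|) @ \oo -->
      `|z - \sum_(m < n0) x m|.
    apply: cvg_norm; apply: cvgB; last exact: cvg_cst.
    by move: xz; rewrite -(cvg_shiftn n0).
  apply: (cvgr_to_le cv); near=> n; rewrite addnC big_split_ord /= addrAC subrr add0r.
  apply: (le_trans (ler_norm_sum _ _ _)); apply: le_trans (tl n).
  by apply: ler_sum => k _.
have ymu m : `|y m| <= mu m.
  by apply: cvgr_to_le (cvg_norm (Fy m)) _; near=> N.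
have /cvgrPdist_le /(_ _ e30) := cvg_sum_ord (n := n0) Fy; apply: filterS => N hN.
have h1 := tail _ _ (Fmu N) (Fsig N); have h2 := tail _ _ ymu yl.
rewrite (_ : l - sigma N = (l - \sum_(m < n0) y m) +
  (\sum_(m < n0) y m - \sum_(m < n0) F N m) - (sigma N - \sum_(m < n0) F N m)); last first.
  by rewrite opprB !addrA !subrK.
apply: (le_trans (ler_normB _ _)); apply: (le_trans (lerD (ler_normD _ _) (lexx _))).
lra.
Unshelve. all: by end_near. Qed.

End Tannery.

(** * Sums over the windows [{-n, ..., n - 1}] and their behaviour under shifts *)

Section Windows.

Definition psum (V : zmodType) (c : int -> V) n : V :=
  \sum_(k < n) (c (Posz k) + c (Negz k)).

Lemma psumS (V : zmodType) (c : int -> V) n :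
  psum c n.+1 = psum c n + (c (Posz n) + c (Negz n)).
Proof. by rewrite /psum big_ord_recr. Qed.

Lemma psum0 (V : zmodType) (c : int -> V) : psum c 0 = 0.
Proof. by rewrite /psum big_ord0. Qed.

Lemma psumD (V : zmodType) (c d : int -> V) n :
  psum (fun u => c u + d u) n = psum c n + psum d n.
Proof. by rewrite /psum -big_split; apply: eq_bigr => k _; rewrite addrACA. Qed.

Lemma eq_psum (V : zmodType) (c d : int -> V) n : c =1 d -> psum c n = psum d n.
Proof. by move=> /funext ->. Qed.

Lemma psum_morph (V W : zmodType) (g : V -> W) (c : int -> V) n :
  {morph g : x y / x + y} -> g 0 = 0 -> psum (fun u => g (c u)) n = g (psum c n).
Proof.
move=> gD g0; rewrite /psum (big_morph g gD g0).
by apply: eq_bigr => k _; rewrite gD.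
Qed.

Lemma psum_sum (V : zmodType) (c : nat -> int -> V) n N :
  psum (fun u => \sum_(m < n) c m u) N = \sum_(m < n) psum (c m) N.
Proof.
rewrite /psum exchange_big; apply: eq_bigr => k _.
by rewrite big_split.
Qed.

(** The window moved one step to the right gains [n] and loses [- n]. *)
Lemma psum_shift1 (V : zmodType) (c : int -> V) n :
  psum (fun u => c (u + 1)) n = psum c n + (c (Posz n) - c (- Posz n)).
Proof.
elim: n => [|n IH]; first by rewrite !psum0 oppr0 subrr addr0.
rewrite !psumS IH NegzE (_ : Posz n + 1 = n.+1); last by lia.
rewrite (_ : - Posz n.+1 + 1 = - Posz n); last by lia.
rewrite -!addrA; congr (_ + (_ + _)).
by rewrite addrCA addNr addr0 addrCA subrr addr0.
Qed.

Variables (R : realType) (V : normedModType R).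
Implicit Types (c : int -> V).

Lemma cvg_psum (F : nat -> int -> V) (l : int -> V) n :
  (forall u, F ^~ u @ \oo --> l u) -> (fun k => psum (F k) n : V) @ \oo --> psum l n.
Proof.
move=> h; apply: (@cvg_sum_ord _ V n (fun k j => F k (Posz j) + F k (Negz j))
  (fun j => l (Posz j) + l (Negz j))) => j.
by apply: cvgD; exact: h.
Qed.

Lemma psum_norm_le c n : `|psum c n| <= psum (fun u => `|c u|) n.
Proof.
apply: (le_trans (ler_norm_sum _ _ _)); apply: ler_sum => k _.
exact: ler_normD.
Qed.

Lemma ler_psum (f g : int -> R) n : (forall u, f u <= g u) -> psum f n <= psum g n.
Proof. by move=> fg; apply: ler_sum => k _; exact: lerD. Qed.

Lemma psum_ge0 (f : int -> R) n : (forall u, 0 <= f u) -> 0 <= psum f n.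
Proof. by move=> f0; apply: sumr_ge0 => k _; exact: addr_ge0. Qed.

Definition has_zsum c (l : V) := (fun n => psum c n : V) @ \oo --> l.

Definition l1_le c M := forall n, psum (fun u => `|c u|) n <= M.

(** A window of half-width [n] moved by [k] stays inside the window of half-width [n + k], and the
    terms are nonnegative. *)
Lemma l1_le_shift c M u : l1_le c M -> l1_le (fun v => c (v + u)) M.
Proof.
move=> cM; pose g v := `|c v|; have g0 v : 0 <= g v by exact: normr_ge0.
suff S (h : int -> R) n k : (forall v, 0 <= h v) ->
    psum (fun v => h (v + k%:Z)) n <= psum h (n + k)%N /\
    psum (fun v => h (v - k%:Z)) n <= psum h (n + k)%N.
  case: u => k n; first by apply: le_trans (cM (n + k)%N); exact: (S g n k g0).1.
  rewrite NegzE; apply: le_trans (cM (n + k.+1)%N); exact: (S g n k.+1 g0).2.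
elim: k n h => [|k IH] n h h0.
  by rewrite addn0; split; rewrite le_eqVlt (eq_psum (d := h)) ?eqxx// => v; rewrite ?addr0 ?subr0.
split.
  rewrite (eq_psum (d := fun v => (fun w => h (w + 1)) (v + k%:Z))); last first.
    by move=> v /=; congr h; lia.
  apply: (le_trans (IH n (fun w => h (w + 1)) (fun w => h0 _)).1).
  rewrite psum_shift1 addnS psumS lerD2l lerD// .
  by rewrite (@le_trans _ _ 0) ?oppr_le0.
rewrite (eq_psum (d := fun v => (fun w => h (w - 1)) (v - k%:Z))); last first.
  by move=> v /=; congr h; lia.
apply: (le_trans (IH n (fun w => h (w - 1)) (fun w => h0 _)).2).
(* The shift to the left is obtained by reading [psum_shift1] backwards, from [h (w - 1)] to [h]. *)
have := psum_shift1 (fun w => h (w - 1)) (n + k); rewrite (eq_psum (d := h)); last first.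
  by move=> v; congr h; lia.
have -> : - Posz (n + k) - 1 = Negz (n + k) by lia.
rewrite addnS psumS => E.
have := h0 (Posz (n + k) - 1); have := h0 (Posz (n + k)); lra.
Qed.

Lemma l1_le_term c M u : l1_le c M -> `|c u| <= M.
Proof.
move=> cM; case: u => n; apply: le_trans (cM n.+1); rewrite psumS.
  have := psum_ge0 n (fun u => normr_ge0 (c u)); have := normr_ge0 (c (Negz n)); lra.
have := psum_ge0 n (fun u => normr_ge0 (c u)); have := normr_ge0 (c (Posz n)); lra.
Qed.

Lemma l1_le_cvg0 c M : l1_le c M -> (fun n => `|c (Posz n)| + `|c (Negz n)|) @ \oo --> (0 : R).
Proof.
move=> cM; apply: cvg_series_cvg_0.
have -> : series (fun n => `|c (Posz n)| + `|c (Negz n)|) = psum (fun u => `|c u|).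
  by apply/funext => n; rewrite /series /= big_mkord.
apply: nondecreasing_is_cvgn; last by exists M => _ [n _ <-]; exact: cM.
by apply/nondecreasing_seqP => n; rewrite psumS lerDl addr_ge0.
Qed.

(** A shift by one changes the window sum by two boundary terms, which tend to 0 by summability;
    larger shifts follow by induction in both directions. *)
Lemma has_zsum_shift c M l u : l1_le c M -> has_zsum c l ->
  has_zsum (fun v => c (v + u)) l.
Proof.
move=> cM cl; rewrite /has_zsum.
have step w : (fun n => psum (fun v => c (v + (w + 1))) n - psum (fun v => c (v + w)) n) @ \oo --> (0 : V).
  have h := l1_le_cvg0 (l1_le_shift w cM).
  (* The lower boundary index [- n] is [Negz n.-1], one step behind its partner in [h], so two
     consecutive terms of [h] are added to dominate it. *)
  have h' : (fun n => `|c (Posz n + w)| + `|c (Negz n.-1 + w)|) @ \oo --> (0 : R).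
    rewrite -(cvg_shiftS _ (nbhs 0)) /=.
    have h0 : (fun n => (`|c (Posz n.+1 + w)| + `|c (Negz n.+1 + w)|) + (`|c (Posz n + w)| + `|c (Negz n + w)|))
        @ \oo --> (0 : R).
      rewrite -[0](addr0 0); apply: cvgD => //.
      by move: h; rewrite -(cvg_shiftS _ (nbhs 0)).
    apply: squeeze_cvgr h0; last exact: (@cvg_cst _ (0 : R)).
    near=> n; rewrite addr_ge0//= addrACA lerD// ?lerDl ?lerDr//.
  apply/norm_cvg0P; move: h'; rewrite -(cvg_shiftS _ (nbhs 0)) => h'.
  rewrite -(cvg_shiftS _ (nbhs 0)) /=; apply: squeeze_cvgr h'; last exact: (@cvg_cst _ (0 : R)).
  near=> n; rewrite normr_ge0 /= (eq_psum (d := fun v => (fun x => c (x + w)) (v + 1))); last first.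
    by move=> v /=; congr c; lia.
  rewrite (psum_shift1 (fun x => c (x + w))) addrAC subrr add0r; apply: (le_trans (ler_normB _ _)).
  by rewrite (_ : - Posz n.+1 = Negz n).
elim/int_ind: u => [|n IH|n IH].
- by under eq_fun do under eq_psum do rewrite addr0.
- rewrite (_ : (fun k => _) = (fun k => (psum (fun v => c (v + (n%:Z + 1))) k -
      psum (fun v => c (v + n%:Z)) k) + psum (fun v => c (v + n%:Z)) k)).
    by rewrite -[l]add0r; apply: cvgD => //; exact: step.
  by apply/funext => k; rewrite subrK; apply: eq_psum => v; congr c; lia.
- rewrite (_ : (fun k => _) = (fun k => psum (fun v => c (v - n%:Z)) k -
      (psum (fun v => c (v + (- n.+1%:Z + 1))) k - psum (fun v => c (v - n.+1%:Z)) k))).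
    by rewrite -[l]subr0; apply: cvgB => //; exact: step.
  apply/funext => k.
  have -> : psum (fun v => c (v - n%:Z)) k = psum (fun v => c (v + (- n.+1%:Z + 1))) k.
    by apply: eq_psum => v; congr c; lia.
  by rewrite opprB addrCA subrr addr0.
Unshelve. all: by end_near. Qed.

Lemma psum_delta (W : zmodType) (u : int) (f : int -> W) N :
  psum (fun v => if v == u then f v else 0) N = if (- N%:Z <= u) && (u < N%:Z) then f u else 0.
Proof.
elim: N => [|N IH]; first by rewrite psum0; case: ifP => //; lia.
rewrite psumS IH; have [h1|h1] := eqVneq (Posz N) u; have [h2|h2] := eqVneq (Negz N) u.
- by exfalso; lia.
- by rewrite -h1 ifF ?ifT ?add0r ?addr0//; lia.
- by rewrite -h2 ifF ?ifT ?add0r ?addr0//; lia.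
- by rewrite !addr0; congr (if _ then _ else _); lia.
Qed.

End Windows.

(** * From lists of atoms to coefficients indexed by the integers *)

Section Regrouping.
Variable R : realType.

(** Repeated frequencies are merged here, which can only lower the l1 norm. *)
Definition fsum (L : seq (R * int)) (v : int) : R :=
  \sum_(b <- L) (if v == b.2 then b.1 else 0).

Lemma fsum_l1_le L : l1_le (fsum L) (\sum_(b <- L) `|b.1|).
Proof.
move=> N; apply: (@le_trans _ _ (\sum_(b <- L) psum (fun v => if v == b.2 then `|b.1| else 0) N)).
  rewrite /psum exchange_big /=; apply: ler_sum => k _.
  by rewrite big_split lerD//; apply: (le_trans (ler_norm_sum _ _ _));
    apply: ler_sum => b _; case: ifP; rewrite ?normr0.
apply: ler_sum => b _; rewrite (psum_delta b.2 (fun=> `|b.1|)).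
by case: ifP.
Qed.

Lemma fsum_has_zsum L (g : int -> R) :
  has_zsum (fun v => g v * fsum L v : R^o) (\sum_(b <- L) b.1 * g b.2).
Proof.
elim: L => [|b L IH]; rewrite /has_zsum.
  rewrite big_nil (_ : (fun n => _) = fun=> 0); first exact: cvg_cst.
  by apply/funext => n; rewrite /psum big1 // => k _; rewrite /fsum !big_nil !mulr0 addr0.
rewrite big_cons (_ : (fun n => _) = (fun n => psum (fun v => if v == b.2 then g v * b.1 else 0) n +
    psum (fun v => g v * fsum L v) n)).
  apply: cvgD; last exact: IH.
  apply: cvg_near_cst; near=> n; rewrite (psum_delta b.2 (fun v => g v * b.1)) ifT 1?mulrC//.
  have : (`|b.2| < n)%N by near: n; exists `|b.2|.+1.
  lia.
apply/funext => n; rewrite -psumD; apply: eq_psum => v.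
by rewrite /fsum big_cons mulrDr; case: ifP; rewrite ?mulr0.
Unshelve. all: by end_near. Qed.

(** One family of coefficients on Z carries two functions: the weights from [s] are symmetric in the
    frequency, so they vanish in sine sums and give the even part of [s] in cosine sums; those from
    [s'] are antisymmetric and give the odd part of [s'] in sine sums. *)
Definition even_odd_atoms (s s' : seq (R * int * R)) : seq (R * int) :=
  [seq (a.1.1 * cos a.2 / 2, a.1.2) | a <- s] ++
  [seq (a.1.1 * cos a.2 / 2, - a.1.2) | a <- s] ++
  [seq (- (a.1.1 * sin a.2 / 2), a.1.2) | a <- s'] ++
  [seq (a.1.1 * sin a.2 / 2, - a.1.2) | a <- s'].

Lemma even_odd_atoms_norm s s' :
  \sum_(b <- even_odd_atoms s s') `|b.1| <= tnorm s + tnorm s'.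
Proof.
have half (x : R) : `|x / 2| + `|x / 2| = `|x|.
  by rewrite normrM normfV (@ger0_norm R 2)//; field.
rewrite !big_cat !big_map /= addrA -!big_split /= lerD//; apply: ler_sum => a _.
  by rewrite half normrM ler_piMr ?cos_max.
by rewrite normrN half normrM ler_piMr ?sin_max.
Qed.

Lemma even_odd_atoms_cos s s' t :
  \sum_(b <- even_odd_atoms s s') b.1 * cos (b.2%:~R * t) = (tsum s t + tsum s (- t)) / 2.
Proof.
rewrite !big_cat !big_map /= addrA -!big_split /= [X in _ + X]big1 ?addr0 => [|a _]; last first.
  by rewrite intrN (mulNr a.1.2%:~R) cosN; ring.
transitivity (\sum_(a <- s) (a.1.1 * cos (a.1.2%:~R * t + a.2) +
    a.1.1 * cos (a.1.2%:~R * - t + a.2)) / 2); last by rewrite -mulr_suml big_split.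
apply: eq_bigr => a _.
by rewrite intrN (mulNr a.1.2%:~R) cosN (mulrN a.1.2%:~R) !cosD cosN sinN; field.
Qed.

Lemma even_odd_atoms_sin s s' t :
  \sum_(b <- even_odd_atoms s s') b.1 * sin (b.2%:~R * t) = (tsum s' t - tsum s' (- t)) / 2.
Proof.
rewrite !big_cat !big_map /= addrA -!big_split /= [X in X + _]big1 ?add0r => [|a _]; last first.
  by rewrite intrN (mulNr a.1.2%:~R) sinN; ring.
rewrite /tsum -sumrB /= mulr_suml; apply: eq_bigr => a _.
by rewrite intrN (mulNr a.1.2%:~R) sinN (mulrN a.1.2%:~R) !cosD cosN sinN; field.
Qed.

Lemma wle_coefs F G M N : wle F M -> wle G N ->
  (forall t, F (- t) = F t) -> (forall t, G (- t) = - G t) ->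
  exists a : int -> R, exists K, l1_le (a : int -> R^o) K /\ forall t,
    has_zsum (fun u => cos (u%:~R * t) * a u : R^o) (F t) /\
    has_zsum (fun u => sin (u%:~R * t) * a u : R^o) (G t).
Proof.
move=> [S [bS cS]] [T [bT cT]] Feven Godd.
pose L m := even_odd_atoms (S m) (T m); pose x m := fsum (L m).
pose mu m := tnorm (S m) + tnorm (T m).
have bmu n : \sum_(m < n) mu m <= M + N by rewrite big_split lerD.
have xmu m : l1_le (x m : int -> R^o) (mu m).
  by move=> n; apply: le_trans (even_odd_atoms_norm _ _); exact: fsum_l1_le.
pose a v := limn (fun n => \sum_(m < n) x m v).
have ca v : (fun n => \sum_(m < n) x m v) @ \oo --> a v.
  apply: (@series_bounded_cvg R (fun m => x m v) (M + N)) => n; apply: le_trans (bmu n).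
  by apply: ler_sum => m _; exact: (l1_le_term v (xmu m)).
(* Exchanges the window sum over frequencies with the sum over [m], for a bounded weight [g] that
   will be the cosine and then the sine. *)
have main (g : int -> R) (y : nat -> R) l : (forall u, `|g u| <= 1) ->
    (forall m, \sum_(b <- L m) b.1 * g b.2 = y m) ->
    (fun n => \sum_(m < n) y m) @ \oo --> l -> has_zsum (fun u => g u * a u : R^o) l.
  move=> g1 gy yl.
  apply: (@tannery R R^o (fun N m => psum (fun u => g u * x m u) N) mu (M + N) y) yl => //.
  - move=> n m; apply: le_trans (xmu m n); apply: (le_trans (psum_norm_le _ _)).
    by apply: ler_psum => u; rewrite normrM ler_piMl.
  - by move=> m; rewrite -gy; exact: fsum_has_zsum.
  - move=> n; rewrite (_ : (fun k => _) = (fun k => psum (fun u => g u * \sum_(m < k) x m u) n)).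
      apply: (@cvg_psum R R^o (fun k u => g u * \sum_(m < k) x m u)) => u.
      by apply: cvgM; [exact: cvg_cst | exact: ca].
    apply/funext => k; rewrite -(psum_sum (fun m u => g u * x m u)); apply: eq_psum => u.
    by rewrite mulr_sumr.
exists a, (M + N); split=> [n|t].
  have cv : (fun k => psum (fun u => `|\sum_(m < k) x m u|) n) @ \oo --> psum (fun u => `|a u|) n.
    apply: (@cvg_psum R R^o (fun k u => `|\sum_(m < k) x m u|)) => u.
    by apply: cvg_norm; exact: ca.
  apply: (cvgr_to_le cv); near=> k; apply: le_trans (bmu k).
  apply: (@le_trans _ _ (\sum_(m < k) psum (fun u => `|x m u|) n)).
    by rewrite -(psum_sum (fun m u => `|x m u|)); apply: ler_psum => u; exact: ler_norm_sum.
  by apply: ler_sum => m _; exact: xmu.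
split.
- apply: (main (fun u => cos (u%:~R * t)) (fun m => (tsum (S m) t + tsum (S m) (- t)) / 2)).
  + by move=> u; exact: cos_max.
  + by move=> m; exact: even_odd_atoms_cos.
  (* [F] equals its own even part, which is what the atoms represent. *)
  rewrite (_ : F t = (F t + F (- t)) / 2); last by rewrite Feven; field.
  under eq_fun do rewrite -mulr_suml big_split /=.
  by apply: cvgM; [apply: cvgD; exact: cS | exact: cvg_cst].
- apply: (main (fun u => sin (u%:~R * t)) (fun m => (tsum (T m) t - tsum (T m) (- t)) / 2)).
  + by move=> u; exact: sin_max.
  + by move=> m; exact: even_odd_atoms_sin.
  rewrite (_ : G t = (G t - G (- t)) / 2); last by rewrite Godd; field.
  under eq_fun do rewrite -mulr_suml sumrB /=.
  by apply: cvgM; [apply: cvgB; exact: cT | exact: cvg_cst].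
Unshelve. all: by end_near. Qed.

End Regrouping.

(** * Quaternions *)

Section Quaternions.
Variable R : realType.
Implicit Types p q : quat R.

Lemma norm_quatE q : `|q| = Num.sqrt (sqnormq q).
Proof. by []. Qed.

Lemma norm_quatM p q : `|p * q| = `|p| * `|q|.
Proof.
rewrite !norm_quatE -sqrtrM ?sqnormq_ge0//.
by congr Num.sqrt; rewrite /sqnormq /=; ring.
Qed.

Lemma norm_quat_sqr p : `|p| ^+ 2 = sqnormq p.
Proof. by rewrite norm_quatE sqr_sqrtr// sqnormq_ge0. Qed.

(** Every index from 3 on returns [q3], so statements about coordinates hold for all natural [m]. *)
Definition coord (m : nat) q : R :=
  match m with 0 => q0 q | 1 => q1 q | 2 => q2 q | _ => q3 q end.

Lemma coordD m p q : coord m (p + q) = coord m p + coord m q.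
Proof. by case: m => [|[|[|m]]]. Qed.

Lemma coordB m p q : coord m (p - q) = coord m p - coord m q.
Proof. by case: m => [|[|[|m]]]. Qed.

Lemma coord0 m : coord m 0 = 0.
Proof. by case: m => [|[|[|m]]]. Qed.

Lemma coordZ m a q : coord m (a *: q) = a * coord m q.
Proof. by case: m => [|[|[|m]]]. Qed.

Lemma ler_coord m q : `|coord m q| <= `|q|.
Proof.
rewrite norm_quatE -sqrtr_sqr ler_wsqrtr// /sqnormq.
have := sqr_ge0 (q0 q); have := sqr_ge0 (q1 q); have := sqr_ge0 (q2 q).
have := sqr_ge0 (q3 q); case: m => [|[|[|m]]] /=; lra.
Qed.

Lemma coord_split q : q = coord 0 q *: 1 + coord 1 q *: Quat 0 1 0 0 +
  coord 2 q *: Quat 0 0 1 0 + coord 3 q *: Quat 0 0 0 1.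
Proof. by apply: quatP => /=; ring. Qed.

Lemma norm_quat_le q : `|q| <= \sum_(m < 4) `|coord m q|.
Proof.
have n1 (a b c d : R) : a ^+ 2 + b ^+ 2 + c ^+ 2 + d ^+ 2 = 1 -> `|Quat a b c d| = 1.
  by move=> h; rewrite norm_quatE /sqnormq /= h sqrtr1.
rewrite {1}(coord_split q) !big_ord_recr big_ord0 /= add0r.
apply: (le_trans (ler_normD _ _)); apply: lerD; last first.
  by rewrite normrZ n1 ?mulr1//; ring.
apply: (le_trans (ler_normD _ _)); apply: lerD; last first.
  by rewrite normrZ n1 ?mulr1//; ring.
apply: (le_trans (ler_normD _ _)); apply: lerD; last first.
  by rewrite normrZ n1 ?mulr1//; ring.
by rewrite normrZ n1 ?mulr1//; ring.
Qed.

Lemma cvg_coord m (f : nat -> quat R) (l : quat R) :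
  f @ \oo --> l -> (fun n => coord m (f n)) @ \oo --> coord m l.
Proof.
move=> /cvgrPdist_le fl; apply/cvgrPdist_le => e /fl; apply: filterS => n.
by apply: le_trans; rewrite -coordB ler_coord.
Qed.

Lemma cvg_quat (f : nat -> quat R) (l : quat R) :
  (forall m, (fun n => coord m (f n)) @ \oo --> coord m l) -> f @ \oo --> l.
Proof.
move=> h; rewrite (coord_split l) (_ : f = fun n => coord 0 (f n) *: 1 +
  coord 1 (f n) *: Quat 0 1 0 0 + coord 2 (f n) *: Quat 0 0 1 0 +
  coord 3 (f n) *: Quat 0 0 0 1); last by apply/funext => n; exact: coord_split.
by apply: cvgD; [apply: cvgD; [apply: cvgD|]|]; apply: cvgZr_tmp; exact: h.
Qed.

Lemma cvg_quatM p q (f : nat -> quat R) (l : quat R) :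
  f @ \oo --> l -> (fun n => p * f n * q) @ \oo --> p * l * q.
Proof.
move=> /cvgrPdist_le fl; apply/cvgrPdist_le => e e0.
(* The added 1 keeps the divisor positive when [p] or [q] is 0. *)
have c0 : 0 < `|p| * `|q| + 1 by rewrite ltr_wpDl// mulr_ge0.
have /fl : 0 < e / (`|p| * `|q| + 1) by rewrite divr_gt0.
apply: filterS => n; rewrite ler_pdivlMr// => h.
rewrite -mulrBl -mulrBr !norm_quatM mulrAC; apply: le_trans h.
by rewrite mulrC ler_wpM2l// lerDl.
Qed.

Lemma quat_series_cvg (f : nat -> quat R) M :
  (forall n, \sum_(m < n) `|f m| <= M) -> cvgn (fun n => \sum_(m < n) f m).
Proof.
move=> fM; pose a m := limn (fun n => \sum_(k < n) coord m (f k)).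
have ca m : (fun n => \sum_(k < n) coord m (f k)) @ \oo --> a m.
  apply: (@series_bounded_cvg R (fun k => coord m (f k)) M) => n.
  by apply: le_trans (fM n); apply: ler_sum => k _; exact: ler_coord.
have cs m n : coord m (\sum_(k < n) f k) = \sum_(k < n) coord m (f k).
  by apply: (big_morph (coord m)); [exact: coordD | exact: coord0].
apply/cvg_ex; exists (Quat (a 0%N) (a 1%N) (a 2%N) (a 3%N)); apply: cvg_quat => m.
under eq_fun do rewrite cs.
by case: m => [|[|[|m]]]; exact: (ca _).
Qed.

Lemma has_zsum_zsum (c : int -> quat R) M : l1_le c M -> has_zsum c (zsum c).
Proof.
move=> cM; have : cvgn (fun n => psum c n : quat R).
  apply: (@quat_series_cvg (fun k => c (Posz k) + c (Negz k)) M) => n.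
  by apply: le_trans (cM n); apply: ler_sum => k _; exact: ler_normD.
rewrite /has_zsum /zsum (_ : series _ = fun n => psum c n) //.
by apply/funext => n; rewrite /series /= big_mkord.
Qed.

Lemma zsumP (c : int -> quat R) l : has_zsum c l -> zsum c = l.
Proof.
rewrite /zsum (_ : series _ = fun n => psum c n).
  by move=> h; apply: cvg_lim => //; exact: norm_hausdorff.
by apply/funext => n; rewrite /series /= big_mkord.
Qed.

(** Windows are finite sets, and every finite set of integers lies in a window, so a finite sum over
    Z amounts to bounded window sums. *)
Lemma abs_summableP (c : int -> quat R) :
  abs_summable c <-> exists M, l1_le c M.
Proof.
pose w n := [seq Posz k | k <- iota 0 n] ++ [seq Negz k | k <- iota 0 n].
have uw n : uniq (w n).
  rewrite cat_uniq !map_inj_uniq ?iota_uniq; try by move=> a b [].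
  rewrite /= andbT; apply/hasPn => _ /mapP[k _ ->].
  by apply/mapP => -[].
have sw (f : int -> R) n : \sum_(u <- w n) f u = psum f n.
  by rewrite /w big_cat !big_map /= !sum_iota -big_split.
rewrite /abs_summable /summable; split=> [sc|[M cM]].
  exists (fine (\esum_(u in [set: int]) `|(`|c u|)%:E|%E)) => n.
  rewrite -sw -lee_fin fineK ?ge0_fin_numE ?esum_ge0//.
  apply: esum_ge; exists [set` w n]; first by split=> //; exact: finite_seq.
  rewrite -fsbig_seq// -sumEFin; apply: lee_sum => u _.
  by rewrite /= normr_id.
apply: (@le_lt_trans _ _ M%:E); last exact: ltry.
apply: ge_ereal_sup => _ [A [finA _] <-].
rewrite fsbig_finite//=; set s : seq int := finmap.enum_fset _.
have us : uniq s by exact: finmap.fset_uniq.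
pose n := (\sum_(u <- s) `|u|.+1)%N.
have sn u : u \in s -> u \in w n.
  move=> su; have : (`|u| < n)%N.
    by rewrite /n (big_rem u su) /= leq_addr.
  rewrite mem_cat; case: u {su} => k kn; apply/orP; [left|right]; apply/mapP; exists k => //.
    by rewrite mem_iota.
  by rewrite mem_iota /=; lia.
under eq_bigr do rewrite normr_id.
rewrite sumEFin lee_fin; apply: le_trans (cM n); rewrite -sw.
rewrite [leRHS](bigID (mem s)) /= -[leLHS]addr0 lerD ?sumr_ge0//.
rewrite (perm_big [seq u <- w n | u \in s]); first by rewrite big_filter.
apply: uniq_perm; rewrite ?filter_uniq// => u.
by rewrite mem_filter; case su: (u \in s) => //=; rewrite sn.
Qed.

(** * Imaginary units and the polar form of unit quaternions *)

Lemma imag_unitP I : imag_unit I <->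
  q0 I = 0 /\ q1 I ^+ 2 + q2 I ^+ 2 + q3 I ^+ 2 = 1 :> R.
Proof.
split=> [ii|[h0 h1]]; last first.
  by apply: quatP; rewrite expr2 /= h0; move: h1; rewrite ?expr2; lra.
have e k := congr1 k ii.
move: (e _ (@q0 R)) (e _ (@q1 R)) (e _ (@q2 R)) (e _ (@q3 R)).
rewrite expr2 /= => e0 e1 e2 e3.
(* The imaginary coordinates of [I ^+ 2] are [2 q0 q_k]; if [q0] were nonzero then [I] would be
   real, with a nonnegative square. *)
have i0 : q0 I = 0.
  apply/eqP/negPn/negP => n0.
  have z1 : q1 I = 0 by apply: (mulfI n0); lra.
  have z2 : q2 I = 0 by apply: (mulfI n0); lra.
  have z3 : q3 I = 0 by apply: (mulfI n0); lra.
  by move: e0; rewrite z1 z2 z3; nra.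
by split=> //; move: e0; rewrite i0 !expr2; lra.
Qed.

Definition qexp (I : quat R) (x : R) : quat R := (cos x)%:A + sin x *: I.

Lemma slice_mul I (a b a' b' : R) : imag_unit I ->
  (a%:A + b *: I) * (a'%:A + b' *: I) = (a * a' - b * b')%:A + (a * b' + b * a') *: I.
Proof.
move=> ii; have II : I * I = -1 by rewrite -expr2.
rewrite !mulrDl !mulrDr -!scalerAl -!scalerAr !mul1r !mulr1 II.
by apply: quatP => /=; ring.
Qed.

Lemma qexpD I x y : imag_unit I -> qexp I (x + y) = qexp I x * qexp I y.
Proof. by move=> ii; rewrite /qexp slice_mul// cosD sinD (addrC (sin x * _)). Qed.

Lemma norm_qexp I x : imag_unit I -> `|qexp I x| = 1.
Proof.
move=> /imag_unitP[h0 h1]; rewrite norm_quatE.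
have -> : sqnormq (qexp I x) =
    cos x ^+ 2 + sin x ^+ 2 * (q1 I ^+ 2 + q2 I ^+ 2 + q3 I ^+ 2).
  by rewrite /sqnormq /qexp /= h0; ring.
by rewrite h1 mulr1 cos2Dsin2 sqrtr1.
Qed.

Lemma qexp0 I : qexp I 0 = 1.
Proof. by rewrite /qexp cos0 sin0 scale1r scale0r addr0. Qed.

Lemma exprz_qexp I x (u : int) : imag_unit I -> qexp I x ^ u = qexp I (u%:~R * x).
Proof.
move=> ii; have pos n : qexp I x ^+ n = qexp I (n%:R * x).
  elim: n => [|n IH]; first by rewrite mul0r qexp0.
  by rewrite exprS IH -qexpD// -natr1; congr qexp; ring.
case: u => n; first exact: pos.
rewrite NegzE -exprnN pos intrN mulNr -[(n.+1 : int)%:~R]/(n.+1%:R).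
set y := _ * x.
have hV : qexp I y * qexp I (- y) = 1 by rewrite -qexpD// subrr qexp0.
have hU : qexp I y \is a GRing.unit.
  apply/unitrP; exists (qexp I (- y)); split=> //.
  by rewrite -qexpD// addrC subrr qexp0.
by apply: (mulrI hU); rewrite hV mulrV.
Qed.

Lemma circle_param (a b : R) : a ^+ 2 + b ^+ 2 = 1 -> exists t, a = cos t /\ b = sin t.
Proof.
move=> h; have a1 : -1 <= a <= 1.
  by have := sqr_ge0 b; move: h; rewrite !expr2 => h hb; apply/andP; split; nra.
have ca : cos (acos a) = a by rewrite acosK// in_itv.
have sa : sin (acos a) = `|b|.
  by rewrite sin_acos// -sqrtr_sqr; congr Num.sqrt; lra.
have [b0|b0] := leP 0 b.
  by exists (acos a); rewrite ca sa ger0_norm.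
by exists (- acos a); rewrite cosN sinN ca sa ltr0_norm// opprK.
Qed.

Lemma usphere_qexp p : usphere p -> exists I t, imag_unit I /\ p = qexp I t.
Proof.
move=> p1; have : sqnormq p = 1 by rewrite -norm_quat_sqr (p1 : `|p| = 1) expr1n.
rewrite /sqnormq => s1.
pose n2 := q1 p ^+ 2 + q2 p ^+ 2 + q3 p ^+ 2.
have n20 : 0 <= n2 by rewrite !addr_ge0 ?sqr_ge0.
(* For real [p] no direction is distinguished and any imaginary unit will do; otherwise [I] is the
   normalized imaginary part. *)
have [n0|nn0] := eqVneq n2 0.
  have [t [pt st]] : exists t, q0 p = cos t /\ 0 = sin t.
    by apply: circle_param; rewrite expr0n /=; move: s1 n0; rewrite /n2; lra.
  have [z1 z2 z3] : [/\ q1 p = 0, q2 p = 0 & q3 p = 0].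
    move/eqP: n0; rewrite /n2 !paddr_eq0 ?addr_ge0 ?sqr_ge0// !sqrf_eq0.
    by move=> /andP[/andP[/eqP -> /eqP ->] /eqP ->].
  exists (Quat 0 1 0 0), t; split.
    by apply/imag_unitP => /=; split=> //; ring.
  by apply: quatP; rewrite /= -?st ?z1 ?z2 ?z3 -?pt; ring.
pose r := Num.sqrt n2; have r2 : r ^+ 2 = n2 by rewrite sqr_sqrtr.
have r0 : r != 0 by apply: contraNneq nn0 => r0; rewrite -r2 r0 expr0n.
have [t [pt st]] : exists t, q0 p = cos t /\ r = sin t.
  by apply: circle_param; rewrite r2 -s1 /n2; ring.
exists (Quat 0 (q1 p / r) (q2 p / r) (q3 p / r)), t; split.
  apply/imag_unitP => /=; split=> //.
  rewrite !expr_div_n -!mulrDl -/n2 -r2 divff//.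
  by rewrite expf_neq0.
by apply: quatP; rewrite /= -?st -?pt; field.
Qed.

Lemma slice_qexp I z : imag_unit I -> slice I z -> usphere z -> exists t, z = qexp I t.
Proof.
move=> /imag_unitP[h0 h1] [x [y ->]] z1.
have : sqnormq (x%:A + y *: I) = 1 by rewrite -norm_quat_sqr (z1 : `|_| = 1) expr1n.
rewrite /sqnormq /= h0 => s1.
have [t [-> ->]] : exists t, x = cos t /\ y = sin t.
  apply: circle_param; rewrite -[LHS]/(x ^+ 2 + y ^+ 2) -[y ^+ 2]mulr1 -{1}h1.
  by rewrite -s1; ring.
by exists t.
Qed.

Lemma qexp_slice I t : imag_unit I -> usphere (qexp I t) /\ slice I (qexp I t).
Proof. by move=> ii; split; [exact: norm_qexp | exists (cos t), (sin t)]. Qed.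

End Quaternions.

(** * Cosine and sine parts of a Laurent series, and the convolution product *)

Section Slices.
Variable R : realType.
Implicit Types (c d : int -> quat R) (I p q : quat R) (t : R).

(* laurent c (cos t + I sin t) = fcos c t + I * fsin c t for all imaginary units I. *)
Definition fcos c t : quat R := zsum (fun u => cos (u%:~R * t) *: c u).
Definition fsin c t : quat R := zsum (fun u => sin (u%:~R * t) *: c u).

Lemma l1_le_mul c M (g : int -> quat R -> quat R) K : 0 <= K -> l1_le c M ->
  (forall u q, `|g u q| <= K * `|q|) -> l1_le (fun u => g u (c u)) (K * M).
Proof.
move=> K0 cM gK n; apply: (@le_trans _ _ (psum (fun u => K * `|c u|) n)).
  by apply: ler_psum => u.
rewrite (psum_morph (g := fun x => K * x)) ?mulr0//; last by move=> x y; rewrite mulrDr.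
by rewrite ler_wpM2l.
Qed.

Lemma fcosP c M t : l1_le c M -> has_zsum (fun u => cos (u%:~R * t) *: c u) (fcos c t).
Proof.
move=> cM; apply: (@has_zsum_zsum _ _ (1 * M)).
apply: (l1_le_mul (g := fun u q => cos (u%:~R * t) *: q) _ cM) => // u q.
by rewrite normrZ ler_wpM2r ?cos_max.
Qed.

Lemma fsinP c M t : l1_le c M -> has_zsum (fun u => sin (u%:~R * t) *: c u) (fsin c t).
Proof.
move=> cM; apply: (@has_zsum_zsum _ _ (1 * M)).
apply: (l1_le_mul (g := fun u q => sin (u%:~R * t) *: q) _ cM) => // u q.
by rewrite normrZ ler_wpM2r ?sin_max.
Qed.

Lemma has_zsumM p q c l : has_zsum c l -> has_zsum (fun u => p * c u * q) (p * l * q).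
Proof.
move=> cl; apply: eq_cvg_seq (cvg_quatM (p := p) (q := q) cl) => n.
rewrite (psum_morph (g := fun x => p * x * q))//.
- by move=> x y; rewrite mulrDr mulrDl.
- by rewrite mulr0 mul0r.
Qed.

Lemma has_zsumD (c d : int -> quat R) k l : has_zsum c k -> has_zsum d l ->
  has_zsum (fun u => c u + d u) (k + l).
Proof. by move=> ck dl; rewrite /has_zsum; under eq_fun do rewrite psumD; apply: cvgD. Qed.

Lemma fcosN c t : fcos c (- t) = fcos c t.
Proof.
rewrite /fcos; congr zsum; apply/funext => u.
by rewrite mulrN cosN.
Qed.

Lemma fsinN c M t : l1_le c M -> fsin c (- t) = - fsin c t.
Proof.
move=> cM; apply: zsumP; have := has_zsumM (p := -1) (q := 1) (fsinP (t := t) cM).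
rewrite mulN1r mulr1; congr has_zsum; apply/funext => u.
by rewrite mulrN sinN mulN1r mulr1 scaleNr.
Qed.

(** The quaternion [q] need not commute with [I]. The case [q = 1] is the Laurent series itself; in
    the convolution formula [q] is the value of the left factor. *)
Lemma has_zsum_qexp c M I t q : l1_le c M ->
  has_zsum (fun u => qexp I (u%:~R * t) * q * c u) (q * fcos c t + I * q * fsin c t).
Proof.
move=> cM; have := has_zsumD (has_zsumM (p := q) (q := 1) (fcosP (t := t) cM))
  (has_zsumM (p := I * q) (q := 1) (fsinP (t := t) cM)).
rewrite !mulr1; congr has_zsum; apply/funext => u; rewrite !mulr1 /qexp.
by rewrite !mulrDl -!scalerAr -!scalerAl mul1r.
Qed.

Lemma laurentE c M I t : l1_le c M -> imag_unit I ->
  laurent c (qexp I t) = fcos c t + I * fsin c t.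
Proof.
move=> cM ii; apply: zsumP; have := has_zsum_qexp (I := I) (t := t) (q := 1) cM.
rewrite !mulr1 mul1r; congr has_zsum; apply/funext => u.
by rewrite mulr1 exprz_qexp.
Qed.

(** At a point [p] the product is [sum_k p^k phi d_k] with [phi = laurent c p], by the substitution
    [u = v + k] in the double sum. In particular it vanishes wherever the left factor does. *)
Lemma laurent_conv c d M N I t : l1_le c M -> l1_le d N -> imag_unit I ->
  laurent (Defs.conv c d) (qexp I t) =
  laurent c (qexp I t) * fcos d t + I * laurent c (qexp I t) * fsin d t.
Proof.
move=> cM dN ii; pose w (u : int) := qexp I (u%:~R * t).
have w1 u : `|w u| = 1 by exact: norm_qexp.
have wD u v : w (u + v) = w u * w v by rewrite /w intrD mulrDl qexpD.
have M0 : 0 <= M by apply: le_trans (cM 0%N); rewrite psum0.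
set phi := laurent c _.
have cphi : has_zsum (fun u => w u * c u) phi.
  rewrite /phi (laurentE t cM ii); have := has_zsum_qexp (I := I) (t := t) (q := 1) cM.
  by rewrite !mulr1 mul1r; congr has_zsum; apply/funext => u; rewrite mulr1.
have cw : l1_le (fun u => w u * c u) M.
  by move=> n; rewrite (eq_psum (d := fun u => `|c u|))// => u; rewrite norm_quatM w1 mul1r.
apply: zsumP; rewrite (_ : (fun u => _) = fun u => w u * Defs.conv c d u); last first.
  by apply/funext => u; rewrite exprz_qexp.
pose x (m : nat) u := c (u - Posz m) * d (Posz m) + c (u - Negz m) * d (Negz m).
have cb (k : int) n : psum (fun u => `|c (u - k) * d k|) n <= M * `|d k|.
  rewrite (eq_psum (d := fun u => `|d k| * `|c (u - k)|)) => [|u]; last by rewrite norm_quatM mulrC.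
  rewrite (psum_morph (g := fun x => `|d k| * x)) ?mulr0//; last by move=> a b; rewrite mulrDr.
  by rewrite mulrC ler_wpM2r//; exact: (l1_le_shift (- k) cM).
(* Here [x m] collects the convolution terms of indices [m] and [- m - 1]; the bound [M * |d k|],
   uniform in the window over [u], justifies the exchange of sums. *)
apply: (@tannery R (quat R) (fun N m => psum (fun u => w u * x m u) N)
   (fun m => M * `|d (Posz m)| + M * `|d (Negz m)|) (M * N)
   (fun m => w (Posz m) * phi * d (Posz m) + w (Negz m) * phi * d (Negz m))).
- move=> n m; apply: (le_trans (psum_norm_le _ _)).
  apply: (@le_trans _ _ (psum (fun u => `|c (u - Posz m) * d (Posz m)| + `|c (u - Negz m) * d (Negz m)|) n)).
    by apply: ler_psum => u; rewrite (norm_quatM (w u)) w1 mul1r ler_normD.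
  by rewrite psumD lerD.
- move=> n; under eq_bigr do rewrite -mulrDr.
  by rewrite -mulr_sumr ler_wpM2l//; exact: dN.
- have key (k : int) : has_zsum (fun u => w u * (c (u - k) * d k)) (w k * phi * d k).
    have h : l1_le (fun u => w k * (w u * c u) * d k) (`|d k| * M).
      apply: (l1_le_mul (g := fun u q => w k * q * d k) _ cw) => // u q.
      by rewrite !norm_quatM w1 mul1r mulrC.
    have := has_zsum_shift (- k) h (has_zsumM (p := w k) (q := d k) cphi).
    congr has_zsum.
    by apply/funext => u; rewrite !mulrA -wD subrKC.
  move=> m; rewrite (_ : (fun n => _) = (fun n => psum (fun u => w u * (c (u - Posz m) * d (Posz m)) +
    w u * (c (u - Negz m) * d (Negz m))) n)).
    by apply: has_zsumD; exact: key.
  by apply/funext => n; apply: eq_psum => u; rewrite mulrDr.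
- move=> n; rewrite (_ : (fun k => _) = (fun k => psum (fun u => w u * psum (fun v => c (u - v) * d v) k) n)).
    apply: (@cvg_psum R (quat R) (fun k u => w u * psum (fun v => c (u - v) * d v) k)) => u.
    have cd : l1_le (fun v => c (u - v) * d v) (M * N).
      apply: (l1_le_mul (g := fun v q => c (u - v) * q) _ dN) => // v q.
      by rewrite norm_quatM ler_wpM2r// (l1_le_term _ cM).
    have := has_zsumM (p := w u) (q := 1) (has_zsum_zsum cd).
    rewrite mulr1; apply: eq_cvg_seq => k.
    rewrite (psum_morph (g := fun x => w u * x * 1)) ?mulr1 ?mulr0//.
    by move=> a b; rewrite !mulr1 mulrDr.
  apply/funext => k; rewrite -(psum_sum (fun m u => w u * x m u)); apply: eq_psum => u.
  by rewrite /psum mulr_sumr.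
- exact: has_zsum_qexp dN.
Qed.

Lemma fcos_coord c M m t : l1_le c M ->
  has_zsum (fun u => cos (u%:~R * t) * coord m (c u) : R^o) (coord m (fcos c t)).
Proof.
move=> cM; apply: eq_cvg_seq (cvg_coord (m := m) (fcosP (t := t) cM)) => n.
rewrite -(psum_morph (g := coord m)); [|exact: coordD|exact: coord0].
apply: eq_psum => u.
by rewrite coordZ.
Qed.

Lemma fsin_coord c M m t : l1_le c M ->
  has_zsum (fun u => sin (u%:~R * t) * coord m (c u) : R^o) (coord m (fsin c t)).
Proof.
move=> cM; apply: eq_cvg_seq (cvg_coord (m := m) (fsinP (t := t) cM)) => n.
rewrite -(psum_morph (g := coord m)); [|exact: coordD|exact: coord0].
apply: eq_psum => u.
by rewrite coordZ.
Qed.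

(** The phase [ph] covers both kinds of series: 0 for cosines, [- pi / 2] for sines. *)
Lemma has_zsum_wle (a : int -> R) (ph : R) (F : R -> R) M :
  (forall n, psum (fun u => `|a u|) n <= M) ->
  (forall t, has_zsum (fun u => a u * cos (u%:~R * t + ph) : R^o) (F t)) -> wle F M.
Proof.
move=> aM aF; exists (fun n => [:: (a (Posz n), Posz n, ph); (a (Negz n), Negz n, ph)]).
split=> [n|t].
  apply: le_trans (aM n); apply: ler_sum => k _.
  by rewrite /tnorm !big_cons big_nil /= addr0.
have := aF t; apply: eq_cvg_seq => n.
by apply: eq_bigr => k _; rewrite /tsum !big_cons big_nil /= addr0.
Qed.

Lemma coord_l1 c M m n : l1_le c M -> psum (fun u => `|coord m (c u)|) n <= M.
Proof. by move=> cM; apply: le_trans (cM n); apply: ler_psum => u; exact: ler_coord. Qed.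

Lemma fcos_wle c M m : l1_le c M -> wle (fun t => coord m (fcos c t)) M.
Proof.
move=> cM; apply: (@has_zsum_wle (fun u => coord m (c u)) 0) => [n|t].
  exact: coord_l1.
have := fcos_coord (m := m) (t := t) cM; congr has_zsum; apply/funext => u.
by rewrite addr0 mulrC.
Qed.

Lemma fsin_wle c M m : l1_le c M -> wle (fun t => coord m (fsin c t)) M.
Proof.
move=> cM; apply: (@has_zsum_wle (fun u => coord m (c u)) (- (pi / 2))) => [n|t].
  exact: coord_l1.
have := fsin_coord (m := m) (t := t) cM; congr has_zsum; apply/funext => u.
by rewrite cosBpihalf mulrC.
Qed.

(** The values at [cos t + I sin t] and [cos t - I sin t] are [A + I B] and [A - I B], which
    determine [A] and [B]. *)
Lemma laurent_inj c d M N t : l1_le c M -> l1_le d N ->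
  (forall p, usphere p -> laurent c p = laurent d p) ->
  fcos c t = fcos d t /\ fsin c t = fsin d t.
Proof.
move=> cM dN e; pose I : quat R := Quat 0 1 0 0.
have ii : imag_unit I by apply/imag_unitP; split=> //=; ring.
have nii : imag_unit (- I) by apply/imag_unitP; split=> /=; ring.
have := e _ (norm_qexp t ii); have := e _ (norm_qexp t nii).
rewrite !(laurentE t cM)// !(laurentE t dN)// !mulNr => e1 e2.
have e3 : fcos c t = fcos d t.
  rewrite -[LHS]Defs.half_double -[RHS]Defs.half_double.
  have := congr2 +%R e1 e2; rewrite ![_ - _ + (_ + _)]addrACA !addNr !addr0 => e3.
  by rewrite e3.
split=> //; move: e2; rewrite e3 => /addrI.
have I0 : I != 0 by apply/eqP => /(congr1 (@q1 R)) /= /eqP; rewrite oner_eq0.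
have uI : I \is a GRing.unit by [].
by move/(mulrI uI).
Qed.

(** [K] may be noncommutative, as the quaternions are, so the order of the factors matters. The
    proof shows that the identity and the transposition are the only permutations of two indices. *)
Lemma det22 (K : nzRingType) (A : 'M[K]_2) : \det A = A 0 0 * A 1 1 - A 0 1 * A 1 0.
Proof.
rewrite /determinant (bigD1 (1%g : 'S_2))//= (bigD1 (tperm 0 1))/=; last first.
  by apply/eqP => /permP /(_ 0); rewrite tpermL perm1 => /eqP.
rewrite [X in _ + (_ + X)]big1 => [|s /andP[s1 s2]]; last first.
  exfalso; move: s1 s2; have [s0|s0] := eqVneq (s 0) 0.
    move=> /eqP[]; apply/permP => k; rewrite perm1.
    have : s 1 != s 0 by rewrite (inj_eq perm_inj).
    rewrite s0; case: (unliftP 0 k) => [j ->|->//].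
    rewrite (ord1 j) (_ : lift 0 0 = 1); last exact: val_inj.
    by move: (s 1) => [[|[|]] //= lt] _; apply: val_inj.
  move=> _ /eqP[]; apply/permP => k.
  have s01 : s 0 = 1 by move: (s 0) s0 => [[|[|]] //= lt] _; apply: val_inj.
  have : s 1 != s 0 by rewrite (inj_eq perm_inj).
  rewrite s01; case: (unliftP 0 k) => [j ->|->]; last by rewrite tpermL.
  rewrite (ord1 j) (_ : lift 0 0 = 1); last exact: val_inj.
  by rewrite tpermR; move: (s 1) => [[|[|]] //= lt] _; apply: val_inj.
rewrite addr0 odd_perm1 odd_tperm /= expr0 expr1 mul1r mulN1r.
rewrite !big_ord_recl !big_ord0 !mulr1 !perm1 (_ : lift 0 0 = 1); last exact: val_inj.
by rewrite tpermL tpermR.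
Qed.

End Slices.

(** * The determinant of [omega] in terms of the cosine and sine parts *)

Section Discriminant.
Variable R : realType.
Implicit Types (A B I i j p q : quat R) (c d : int -> quat R).

Definition innerq p q : R := q0 p * q0 q + q1 p * q1 q + q2 p * q2 q + q3 p * q3 q.

(* disc_re A B + disc_im A B * i is the value of det omega(f) at cos t + i sin t
   when f (cos t + I sin t) = A + I B. *)
Definition disc_re A B : R := innerq A A - innerq B B.
Definition disc_im A B : R := 2 * innerq A B.

Lemma imag_unit_inner I : imag_unit I -> q0 I = 0 /\ innerq I I = 1.
Proof. by move=> /imag_unitP[h0 h1]; split=> //; rewrite /innerq h0 -h1; ring. Qed.

(** From [A = - I B]: left multiplication by [I] preserves the norm, and [I B] is orthogonal to [B]
    because [I] has real part 0. *)
Lemma disc_eq0 A B I : imag_unit I -> A + I * B = 0 -> disc_re A B = 0 /\ disc_im A B = 0.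
Proof.
move=> /imag_unit_inner[h0 h1] /eqP; rewrite addr_eq0 => /eqP ->.
have e1 : innerq (- (I * B)) (- (I * B)) = innerq I I * innerq B B by rewrite /innerq /=; ring.
have e2 : innerq (- (I * B)) B = - (q0 I * innerq B B) by rewrite /innerq /=; ring.
by rewrite /disc_re /disc_im e1 e2 h0 h1 mul1r subrr mul0r oppr0 mulr0.
Qed.

Lemma innerq_eq0 q : innerq q q = 0 -> q = 0.
Proof.
move=> h; apply/eqP; rewrite -sqnormq_eq0 /sqnormq -[X in _ == X]h /innerq !expr2.
exact: eqxx.
Qed.

Lemma disc_eq0_root A B : disc_re A B = 0 -> disc_im A B = 0 ->
  exists I, imag_unit I /\ A + I * B = 0.
Proof.
rewrite /disc_re /disc_im => /eqP; rewrite subr_eq0 => /eqP AB AB0.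
have {}AB0 : innerq A B = 0 by lra.
have [B0|B0] := eqVneq B 0.
  exists (Quat 0 1 0 0); split; first by apply/imag_unitP; split=> //=; ring.
  rewrite B0 mulr0 addr0; apply: innerq_eq0.
  by rewrite AB B0 /innerq /=; ring.
have n0 : innerq B B != 0 by apply: contra_neq B0; exact: innerq_eq0.
(* This is [- A B^-1]; its real part is [- <A, B> / |B|^2 = 0] and its norm is [|A| / |B| = 1]. *)
exists (- ((innerq B B)^-1 *: (A * conjq B))); split.
  have h0 : q0 (- ((innerq B B)^-1 *: (A * conjq B))) = 0.
    transitivity (- ((innerq B B)^-1 * innerq A B)); last by rewrite AB0 mulr0 oppr0.
    by move: (innerq B B)^-1 => x; rewrite /innerq /=; ring.
  apply/imag_unitP; split=> //.
  set J := - _ in h0 *.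
  have : innerq J J = 1.
    have -> : innerq J J = (innerq B B)^-1 ^+ 2 * (innerq A A * innerq B B).
      by rewrite /J /=; move: (innerq B B)^-1 => x; rewrite /innerq /=; ring.
    by rewrite AB; field.
  by rewrite /innerq h0 => <-; ring.
have -> : - ((innerq B B)^-1 *: (A * conjq B)) * B = - ((innerq B B)^-1 *: (innerq B B *: A)).
  by move: (innerq B B)^-1 => x; apply: quatP; rewrite /innerq /=; ring.
by rewrite scalerA mulVf// scale1r subrr.
Qed.

Lemma mulq_complexified A B A' B' I : imag_unit I ->
  (A + I * B) * A' + I * (A + I * B) * B' = (A * A' - B * B') + I * (B * A' + A * B').
Proof.
move=> ii; have II : I * I = -1 by rewrite -expr2.
rewrite !mulrDr !mulrDl (mulrA I I) II mulN1r mulNr !mulrA.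
by rewrite -!addrA; congr (_ + _); rewrite addrC -!addrA addrC -!addrA.
Qed.

(** The family [1, i, j, i j] is orthonormal. *)
Lemma innerq_basis i j (a1 a2 g1 g2 b1 b2 d1 d2 : R) :
  imag_unit i -> imag_unit j -> orthogonal_units i j ->
  innerq ((a1%:A + a2 *: i) + (g1%:A + g2 *: i) * j) ((b1%:A + b2 *: i) + (d1%:A + d2 *: i) * j) =
  a1 * b1 + a2 * b2 + g1 * d1 + g2 * d2.
Proof.
move=> /imag_unit_inner[i0 ii] /imag_unit_inner[j0 jj] ij.
have ij0 : innerq i j = 0.
  by have := congr1 (@q0 R) ij; rewrite /= /innerq i0 j0; lra.
have ik : innerq i (i * j) = innerq i i * q0 j by rewrite /innerq /=; ring.
have jk : innerq j (i * j) = innerq j j * q0 i by rewrite /innerq /=; ring.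
have kk : innerq (i * j) (i * j) = innerq i i * innerq j j by rewrite /innerq /=; ring.
have k0 : q0 (i * j) = 2 * q0 i * q0 j - innerq i j by rewrite /innerq /=; ring.
rewrite !mulrDl -!scalerAl !mul1r; move: (i * j) ik jk kk k0 => k ik jk kk k0.
transitivity (a1 * b1 + a2 * b2 * innerq i i + g1 * d1 * innerq j j + g2 * d2 * innerq k k
   + (a1 * b2 + a2 * b1) * q0 i + (a1 * d1 + g1 * b1) * q0 j + (a1 * d2 + g2 * b1) * q0 k
   + (a2 * d1 + g1 * b2) * innerq i j + (a2 * d2 + g2 * b2) * innerq i k
   + (g1 * d2 + g2 * d1) * innerq j k); first by rewrite /innerq /=; ring.
by rewrite ik jk kk k0 ii jj ij0 i0 j0; ring.
Qed.

(** The contribution of one slice component to the determinant: its value at [z] times the conjugate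
    of its value at the conjugate of [z], where the sine part changes sign. *)
Lemma slice_disc i (a1 a2 b1 b2 : R) : imag_unit i ->
  ((a1%:A + a2 *: i) + i * (b1%:A + b2 *: i)) * conjq ((a1%:A + a2 *: i) - i * (b1%:A + b2 *: i)) =
  (a1 ^+ 2 + a2 ^+ 2 - b1 ^+ 2 - b2 ^+ 2)%:A + (2 * (a1 * b1 + a2 * b2)) *: i.
Proof.
move=> ii; have [i0 _] := imag_unit_inner ii; have II : i * i = -1 by rewrite -expr2.
have e : i * (b1%:A + b2 *: i) = (- b2)%:A + b1 *: i.
  rewrite mulrDr -!scalerAr mulr1 II addrC; congr (_ + _).
  by rewrite scalerN scaleNr.
have -> : conjq ((a1%:A + a2 *: i) - i * (b1%:A + b2 *: i)) = (a1 + b2)%:A + (b1 - a2) *: i.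
  by rewrite e; apply: quatP => /=; rewrite ?i0; ring.
rewrite e addrACA -!scalerDl slice_mul//.
by congr (_ *: _ + _ *: _); ring.
Qed.

Lemma scalar_imag_eq0 i (x y : R) : imag_unit i -> x%:A + y *: i = 0 -> x = 0 /\ y = 0.
Proof.
move=> /imag_unit_inner[i0 ii] e.
have x0 : x = 0 by have := congr1 (@q0 R) e; rewrite /= i0; lra.
split=> //; move: e; rewrite x0 scale0r add0r => /eqP; rewrite scaler_eq0.
by case/orP => /eqP // i00; move/eqP: ii; rewrite i00 /innerq /= !mulr0 !addr0 eq_sym oner_eq0.
Qed.

(** A shape of real-linear maps that includes both slice components, so that these commute with
    [fcos] and [fsin]. *)
Definition bimul (a b a' b' : quat R) q := a * q * b + a' * q * b'.

Lemma bimulZ a b a' b' (x : R) q : bimul a b a' b' (x *: q) = x *: bimul a b a' b' q.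
Proof. by rewrite /bimul -!scalerAr -!scalerAl scalerDr. Qed.

Lemma l1_le_bimul a b a' b' c M : l1_le c M ->
  l1_le (fun u => bimul a b a' b' (c u)) ((`|a| * `|b| + `|a'| * `|b'|) * M).
Proof.
move=> cM; apply: (l1_le_mul (g := fun _ => bimul a b a' b') _ cM) => [|_ q].
  by rewrite addr_ge0 ?mulr_ge0.
apply: (le_trans (ler_normD _ _)); rewrite !norm_quatM mulrDl.
by rewrite (mulrAC `|a|) (mulrAC `|a'|).
Qed.

Lemma fcos_bimul a b a' b' c M t : l1_le c M ->
  fcos (fun u => bimul a b a' b' (c u)) t = bimul a b a' b' (fcos c t).
Proof.
move=> cM; apply: zsumP; have h := fcosP (t := t) cM.
have := has_zsumD (has_zsumM (p := a) (q := b) h) (has_zsumM (p := a') (q := b') h).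
by congr has_zsum; apply/funext => u; rewrite -bimulZ.
Qed.

Lemma fsin_bimul a b a' b' c M t : l1_le c M ->
  fsin (fun u => bimul a b a' b' (c u)) t = bimul a b a' b' (fsin c t).
Proof.
move=> cM; apply: zsumP; have h := fsinP (t := t) cM.
have := has_zsumD (has_zsumM (p := a) (q := b) h) (has_zsumM (p := a') (q := b') h).
by congr has_zsum; apply/funext => u; rewrite -bimulZ.
Qed.

Lemma slice_fstE i q : slice_fst i q = bimul (2^-1)%:A 1 (- (2^-1 *: i)) i q.
Proof. by apply: quatP => /=; ring. Qed.

Lemma slice_sndE i j q : slice_snd i j q = bimul (- 2^-1)%:A j (- (2^-1 *: i)) (i * j) q.
Proof. by apply: quatP => /=; ring. Qed.

Lemma conjq_qexp i t : imag_unit i -> conjq (qexp i t) = qexp i (- t).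
Proof.
move=> /imag_unit_inner[i0 _]; rewrite /qexp cosN sinN.
by apply: quatP => /=; rewrite ?i0; ring.
Qed.

Lemma slice_fst_laurent i c M : l1_le c M -> exists K,
  l1_le (fun u => slice_fst i (c u)) K /\ forall t,
  fcos (fun u => slice_fst i (c u)) t = slice_fst i (fcos c t) /\
  fsin (fun u => slice_fst i (c u)) t = slice_fst i (fsin c t).
Proof.
move=> cM; rewrite (_ : (fun u => _) = fun u => bimul (2^-1)%:A 1 (- (2^-1 *: i)) i (c u)).
  eexists; split; first exact: l1_le_bimul cM.
  by move=> t; rewrite !slice_fstE (fcos_bimul _ _ _ _ _ cM) (fsin_bimul _ _ _ _ _ cM).
by apply/funext => u; exact: slice_fstE.
Qed.

Lemma slice_snd_laurent i j c M : l1_le c M -> exists K,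
  l1_le (fun u => slice_snd i j (c u)) K /\ forall t,
  fcos (fun u => slice_snd i j (c u)) t = slice_snd i j (fcos c t) /\
  fsin (fun u => slice_snd i j (c u)) t = slice_snd i j (fsin c t).
Proof.
move=> cM; rewrite (_ : (fun u => _) = fun u => bimul (- 2^-1)%:A j (- (2^-1 *: i)) (i * j) (c u)).
  eexists; split; first exact: l1_le_bimul cM.
  by move=> t; rewrite !slice_sndE (fcos_bimul _ _ _ _ _ cM) (fsin_bimul _ _ _ _ _ cM).
by apply/funext => u; exact: slice_sndE.
Qed.

(** The two signs in the second column product cancel, so the determinant is the sum of the
    [slice_disc] contributions of both components; by orthonormality these add up to the inner
    products of the full [A] and [B]. *)
Lemma det_omega i j (f : quat R -> quat R) M t :
  imag_unit i -> imag_unit j -> orthogonal_units i j -> l1_le (coef f) M ->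
  \det (omega i j f (qexp i t)) =
  (disc_re (fcos (coef f) t) (fsin (coef f) t))%:A + disc_im (fcos (coef f) t) (fsin (coef f) t) *: i.
Proof.
move=> ii jj ij cM; rewrite det22 !mxE /= mulrN opprK conjq_qexp//.
have [K [aK aE]] := slice_fst_laurent i cM; have [L [bL bE]] := slice_snd_laurent i j cM.
rewrite !(laurentE _ aK ii) !(laurentE _ bL ii) !fcosN (fsinN _ aK) (fsinN _ bL) !mulrN.
rewrite !(aE t).1 !(aE t).2 !(bE t).1 !(bE t).2.
rewrite /disc_re /disc_im; set A := fcos _ _; set B := fsin _ _.
have AE := slice_splitE i A jj; have BE := slice_splitE i B jj.
have [a1 [a2 ea]] := slice_fstP A ii; have [g1 [g2 eg]] := slice_sndP A ii ij.
have [b1 [b2 eb]] := slice_fstP B ii; have [d1 [d2 ed]] := slice_sndP B ii ij.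
rewrite ea eg in AE *; rewrite eb ed in BE *; rewrite AE BE.
rewrite !slice_disc// !innerq_basis// addrACA -!scalerDl.
by congr (_ *: _ + _ *: _); ring.
Qed.

Lemma star_qexp c d M N I t : l1_le c M -> l1_le d N -> imag_unit I ->
  laurent (Defs.conv c d) (qexp I t) =
  (fcos c t * fcos d t - fsin c t * fsin d t) +
  I * (fsin c t * fcos d t + fcos c t * fsin d t).
Proof.
move=> cM dN ii; rewrite (laurent_conv t cM dN ii) (laurentE t cM ii).
exact: mulq_complexified.
Qed.

End Discriminant.

(** * Construction of the inverse from its cosine and sine parts *)

Section Inversion.
Variable R : realType.
Implicit Types (F G : R -> R) (c d : int -> quat R).

Definition in_wiener F := exists M, wle F M.

Lemma in_wienerD F G : in_wiener F -> in_wiener G -> in_wiener (fun t => F t + G t).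
Proof. by move=> [M FM] [N GN]; exists (M + N); exact: wleD. Qed.

Lemma in_wienerM F G : in_wiener F -> in_wiener G -> in_wiener (fun t => F t * G t).
Proof. by move=> [M FM] [N GN]; exists (M * N); exact: wleM. Qed.

Lemma in_wienerZ a F : in_wiener F -> in_wiener (fun t => a * F t).
Proof. by move=> [M FM]; exists (`|a| * M); exact: wleZ. Qed.

Lemma in_wienerN F : in_wiener F -> in_wiener (fun t => - F t).
Proof.
move=> /(in_wienerZ (-1)) [M FM]; exists M; apply: wle_ext FM => t.
by rewrite mulN1r.
Qed.

Lemma in_wiener_innerq (A B : R -> quat R) :
  (forall m, in_wiener (fun t => coord m (A t))) ->
  (forall m, in_wiener (fun t => coord m (B t))) ->
  in_wiener (fun t => innerq (A t) (B t)).
Proof.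
move=> hA hB; rewrite /innerq.
by apply: in_wienerD; [apply: in_wienerD; [apply: in_wienerD|]|];
  [exact: (in_wienerM (hA 0%N) (hB 0%N)) | exact: (in_wienerM (hA 1%N) (hB 1%N))
  |exact: (in_wienerM (hA 2%N) (hB 2%N)) | exact: (in_wienerM (hA 3%N) (hB 3%N))].
Qed.

Lemma quat_coefs (E O : R -> quat R) :
  (forall m, in_wiener (fun t => coord m (E t))) ->
  (forall m, in_wiener (fun t => coord m (O t))) ->
  (forall t, E (- t) = E t) -> (forall t, O (- t) = - O t) ->
  exists d M, l1_le d M /\ forall t, fcos d t = E t /\ fsin d t = O t.
Proof.
move=> wE wO Eeven Oodd.
have /choice[a /choice[K aK]] m : exists a : int -> R, exists K, l1_le (a : int -> R^o) K /\ forall t,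
    has_zsum (fun u => cos (u%:~R * t) * a u : R^o) (coord m (E t)) /\
    has_zsum (fun u => sin (u%:~R * t) * a u : R^o) (coord m (O t)).
  have [M EM] := wE m; have [N ON] := wO m.
  apply: wle_coefs EM ON _ _ => t; first by rewrite Eeven.
  by rewrite Oodd -[- O t]add0r coordB coord0 add0r.
pose d u := Quat (a 0%N u) (a 1%N u) (a 2%N u) (a 3%N u).
have dM : l1_le d (\sum_(m < 4) K m).
  move=> n; apply: (@le_trans _ _ (psum (fun u => \sum_(m < 4) `|a m u|) n)).
    apply: ler_psum => u; apply: (le_trans (norm_quat_le _)).
    by rewrite !big_ord_recr !big_ord0.
  rewrite (psum_sum (fun m u => `|a m u|)); apply: ler_sum => m _.
  exact: (aK m).1.
exists d, (\sum_(m < 4) K m); split=> // t.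
have uniqR (b : int -> R^o) (x y : R^o) : has_zsum b x -> has_zsum b y -> x = y.
  by apply: cvg_unique; exact: norm_hausdorff.
(* Beyond 3 the choice [a m] is independent of [a 3], while [coord m] repeats [q3]. *)
have key m : (m < 4)%N -> coord m (fcos d t) = coord m (E t) /\ coord m (fsin d t) = coord m (O t).
  move=> m4; have dm u : coord m (d u) = a m u by move: m m4 => [|[|[|[|]]]].
  split.
    apply: uniqR (fcos_coord (m := m) (t := t) dM) _; under eq_fun do rewrite dm.
    exact: ((aK m).2 t).1.
  apply: uniqR (fsin_coord (m := m) (t := t) dM) _; under eq_fun do rewrite dm.
  exact: ((aK m).2 t).2.
split; apply: quatP.
- exact: (key 0%N _).1.
- exact: (key 1%N _).1.
- exact: (key 2%N _).1.
- exact: (key 3%N _).1.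
- exact: (key 0%N _).2.
- exact: (key 1%N _).2.
- exact: (key 2%N _).2.
- exact: (key 3%N _).2.
Qed.

(** The pointwise formulas come from one coefficient sequence because of parity: [x] and [G] are
    even and [y] is odd in [t], which makes the cosine part even and the sine part odd, as
    [quat_coefs] requires. *)
Lemma disc_inverse c M : l1_le c M ->
  (forall t, disc_re (fcos c t) (fsin c t) = 0 -> disc_im (fcos c t) (fsin c t) = 0 -> False) ->
  exists d N, l1_le d N /\ forall t, exists G : R,
    let A := fcos c t in let B := fsin c t in
    [/\ (disc_re A B ^+ 2 + disc_im A B ^+ 2) * G = 1,
     fcos d t = (disc_re A B * G) *: conjq A + (disc_im A B * G) *: conjq B &
     fsin d t = (disc_re A B * G) *: conjq B - (disc_im A B * G) *: conjq A].
Proof.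
move=> cM nz.
pose A t := fcos c t; pose B t := fsin c t.
pose x t := disc_re (A t) (B t); pose y t := disc_im (A t) (B t).
have wA m : in_wiener (fun t => coord m (A t)) by exists M; exact: fcos_wle.
have wB m : in_wiener (fun t => coord m (B t)) by exists M; exact: fsin_wle.
have wx : in_wiener x.
  by apply: in_wienerD; [|apply: in_wienerN]; exact: in_wiener_innerq.
have wy : in_wiener y by apply: in_wienerZ; exact: in_wiener_innerq.
have [H wH] : in_wiener (fun t => x t * x t + y t * y t).
  by apply: in_wienerD; exact: in_wienerM.
have Hpos t : 0 < x t * x t + y t * y t.
  rewrite -!expr2 lt_def addr_ge0 ?sqr_ge0// andbT paddr_eq0 ?sqr_ge0// !sqrf_eq0.
  by apply/negP => /andP[/eqP x0 /eqP y0]; exact: (nz t).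
have [G [N [wG HG]]] := wiener_lemma wH (fun t _ => Hpos t).
have wG' : in_wiener G by exists N.
have Ae t : A (- t) = A t by exact: fcosN.
have Bo t : B (- t) = - B t by exact: (fsinN _ cM).
have xe t : x (- t) = x t by rewrite /x Ae Bo /disc_re /innerq /=; ring.
have yo t : y (- t) = - y t by rewrite /y Ae Bo /disc_im /innerq /=; ring.
(* [G] is known only through [HG]; the equations at [t] and [- t] have the same nonzero factor. *)
have Ge t : G (- t) = G t.
  apply: (mulfI (lt0r_neq0 (Hpos t))); rewrite HG -[RHS](HG (- t)) xe yo.
  by rewrite mulrNN.
have wc m (C : R -> quat R) : (forall k, in_wiener (fun t => coord k (C t))) ->
    in_wiener (fun t => coord m (conjq (C t))).
  by move=> wC; case: m => [|[|[|m]]] /=; [exact: (wC 0%N) | exact: in_wienerN (wC 1%N)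
    | exact: in_wienerN (wC 2%N) | exact: in_wienerN (wC 3%N)].
pose E t := (x t * G t) *: conjq (A t) + (y t * G t) *: conjq (B t).
pose O t := (x t * G t) *: conjq (B t) - (y t * G t) *: conjq (A t).
have [d [K [dK dE]]] : exists d M, l1_le d M /\ forall t, fcos d t = E t /\ fsin d t = O t.
  apply: quat_coefs.
  - move=> m; rewrite /E; under eq_fun do rewrite coordD !coordZ.
    by apply: in_wienerD; apply: in_wienerM;
      [exact: in_wienerM | exact: wc | exact: in_wienerM | exact: wc].
  - move=> m; rewrite /O; under eq_fun do rewrite coordB !coordZ.
    apply: in_wienerD; [|apply: in_wienerN]; apply: in_wienerM;
      [exact: in_wienerM | exact: wc | exact: in_wienerM | exact: wc].
  - by move=> t; rewrite /E xe yo Ge Ae Bo; apply: quatP => /=; ring.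
  - by move=> t; rewrite /O xe yo Ge Ae Bo; apply: quatP => /=; ring.
exists d, K; split=> // t; exists (G t) => /=.
by rewrite (dE t).1 (dE t).2 !expr2; split => //; exact: HG.
Qed.

(** In the complexified quaternions, with a central root [e] of -1, the element [A + e B] times
    [conjq A + e conjq B] is the complex number [x + e y]. So the inverse is [(x - e y) (conjq A + e
    conjq B) / (x^2 + y^2)], whose two components are [A'] and [B']. *)
Lemma disc_mulV (A B : quat R) (G : R) : (disc_re A B ^+ 2 + disc_im A B ^+ 2) * G = 1 ->
  let A' := (disc_re A B * G) *: conjq A + (disc_im A B * G) *: conjq B in
  let B' := (disc_re A B * G) *: conjq B - (disc_im A B * G) *: conjq A in
  [/\ A * A' - B * B' = 1, B * A' + A * B' = 0, A' * A - B' * B = 1 & B' * A + A' * B = 0].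
Proof.
move=> hG /=.
have -> : (1 : quat R) = ((disc_re A B ^+ 2 + disc_im A B ^+ 2) * G)%:A by rewrite hG scale1r.
by split; apply: quatP; rewrite /= /disc_re /disc_im /innerq; ring.
Qed.

End Inversion.

Theorem theorem2p5 (R : realType) (f : quat R -> quat R) (i j : quat R)
    (hf : wiener f) (hi : imag_unit i) (hj : imag_unit j)
    (hij : orthogonal_units i j) :
  [<-> star_invertible f;
       forall z : quat R, usphere z -> slice i z -> \det (omega i j f z) <> 0;
       forall p : quat R, usphere p -> f p <> 0].
Proof.
have coefP (h : quat R -> quat R) : wiener h -> exists M, l1_le (coef h) M /\
    forall p, usphere p -> h p = laurent (coef h) p.
  by move=> /getPex[/abs_summableP[M hM] hE]; exists M.
have [M [cM fE]] := coefP f hf.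
tfae.
- move=> [g [wg fg1 _]] z zS zi; have [t ->] := slice_qexp hi zi zS.
  rewrite (det_omega _ hi hj hij cM) => /(scalar_imag_eq0 hi)[x0 y0].
  have [I [hI AB]] := disc_eq0_root x0 y0.
  have [N [dN _]] := coefP g wg.
  (* At [cos t + I sin t] the left factor [f] vanishes, hence so does [star f g], which should be
     1. *)
  have := fg1 _ (norm_qexp t hI).
  rewrite /star (laurent_conv t cM dN hI) (laurentE t cM hI) AB mulr0 !mul0r addr0.
  by move/eqP; rewrite eq_sym oner_eq0.
- move=> D _ /usphere_qexp [I [t [hI ->]]].
  rewrite fE ?(laurentE t cM hI); last exact: norm_qexp.
  move=> /(disc_eq0 hI)[x0 y0]; have [zS zi] := qexp_slice t hi.
  by apply: (D _ zS zi); rewrite (det_omega _ hi hj hij cM) x0 y0 !scale0r addr0.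
- move=> nz; have [t x0 y0|d [N [dN dE]]] := disc_inverse cM.
    have [I [hI AB]] := disc_eq0_root x0 y0.
    by apply: (nz _ (norm_qexp t hI)); rewrite fE ?(laurentE t cM hI)//; exact: norm_qexp.
  have wg : wiener (laurent d) by exists d; split=> //; apply/abs_summableP; exists N.
  have [K [gK gE]] := coefP _ wg.
  (* [star] uses the coefficients picked by [coef]; it is enough that they have the same cosine and
     sine parts as [d], since [star_qexp] depends on nothing else. *)
  have gd t := laurent_inj t gK dN (fun p hp => esym (gE p hp)).
  exists (laurent d); split=> // p /usphere_qexp [I [t [hI ->]]]; rewrite /star.
  + rewrite (star_qexp t cM gK hI) (gd t).1 (gd t).2.
    have [G [/disc_mulV[e1 e2 _ _] -> ->]] := dE t.
    by rewrite e1 e2 mulr0 addr0.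
  + rewrite (star_qexp t gK cM hI) (gd t).1 (gd t).2.
    have [G [/disc_mulV[_ _ e1 e2] -> ->]] := dE t.
    by rewrite e1 e2 mulr0 addr0.
Qed.
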